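(* Let $\gamma,\delta\in[0,1]$ with $\gamma$ irrational, and let $\mathbf{u}$ be a word coding the two interval exchange transformation with parameters $\ell_0 = 1-\gamma$, $\ell_1 = \gamma$, $\rho = \delta$. If $\mathbf{u}$ is fixed by a primitive substitution $\varphi$, then $\varphi$ is closeable under derivation if and only if $\delta\in\{0,\gamma,1-\gamma,1\}$.
   Context: Two interval exchange coding: given $\ell_0,\ell_1>0$, take either $I=[0,\ell_0+\ell_1)$, $I_0=[0,\ell_0)$, $I_1=[\ell_0,\ell_0+\ell_1)$ (lower case) or $I=(0,\ell_0+\ell_1]$, $I_0=(0,\ell_0]$, $I_1=(\ell_0,\ell_0+\ell_1]$ (upper case); $T(x)=x+\ell_1$ on $I_0$ and $T(x)=x-\ell_0$ on $I_1$; for $\rho\in I$ the coding is $u_n=0$ if $T^n(\rho)\in I_0$, $u_n=1$ if $T^n(\rho)\in I_1$. A morphism is primitive if some power maps every letter to a word containing every letter; a substitution is a morphism $\psi$ with a letter $c$ such that $\psi(c)=cx$, $x$ nonempty, $|\psi^n(c)|\to\infty$. Derived word: for a uniformly recurrent word $\mathbf{u}$ and factor $v$, a return word of $v$ is a factor $r$ such that $rv$ is a factor in which $v$ occurs exactly twice (as prefix and suffix); with $r_0,\dots,r_k$ all return words and $\mathbf{u}=p\,r_{s_0}r_{s_1}\cdots$, $|p|$ the first occurrence of $v$, $\mathbf{d}_{\mathbf{u}}(v)=s_0s_1\cdots$, up to permutation of letters. A finite set $M$ of primitive substitutions is closed under derivation if for every $\varphi\in M$, every fixed point $\mathbf{u}$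 of $\varphi$ and every factor $v$ of $\mathbf{u}$, $\mathbf{d}_{\mathbf{u}}(v)$ is fixed by some primitive substitution $\psi\in M$; a primitive substitution is closeable under derivation if it belongs to some finite set closed under derivation. *)

(* Defs.v *)
From HB Require Import structures.
From mathcomp Require Import all_boot all_order all_algebra.
From mathcomp Require Import reals.
Set Implicit Arguments. Unset Strict Implicit. Unset Printing Implicit Defensive.
Import Order.TTheory GRing.Theory Num.Theory.

(* Infinite words: nat -> nat.  A morphism on the alphabet {0,..,k-1} is
   represented by the list of its images phi = [:: phi(0); ...; phi(k-1)]. *)
Definition morph := seq (seq nat).
Definition alph (phi : morph) : nat := size phi.
Definition img (phi : morph) (a : nat) : seq nat := nth [::] phi a.
Definition mapply (phi : morph) (w : seq nat) : seq nat :=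
  flatten (map (img phi) w).
Definition mpow (phi : morph) (n : nat) (w : seq nat) : seq nat :=
  iter n (mapply phi) w.

Definition morph_wf (phi : morph) : Prop :=
  forall a b, a < alph phi -> b \in img phi a -> b < alph phi.

Definition primitive (phi : morph) : Prop :=
  morph_wf phi /\
  exists n, 0 < n /\
    forall a b, a < alph phi -> b < alph phi -> b \in mpow phi n [:: a].

Definition substitution (phi : morph) : Prop :=
  morph_wf phi /\
  exists c, c < alph phi /\
    (exists x, x != [::] /\ img phi c = c :: x) /\
    (forall N, exists n, N <= size (mpow phi n [:: c])).

Definition primitive_substitution (phi : morph) : Prop :=
  primitive phi /\ substitution phi.

Definition prefix (u : nat -> nat) (n : nat) : seq nat := mkseq u n.

Definition fixed_by (phi : morph) (u : nat -> nat) : Prop :=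
  (forall i, u i < alph phi) /\
  (forall n i, i < size (mapply phi (prefix u n)) ->
      nth 0 (mapply phi (prefix u n)) i = u i) /\
  (forall N, exists n, N <= size (mapply phi (prefix u n))).

Definition occurs_at (u : nat -> nat) (v : seq nat) (i : nat) : Prop :=
  forall j, j < size v -> u (i + j) = nth 0 v j.

Definition factor (u : nat -> nat) (v : seq nat) : Prop :=
  exists i, occurs_at u v i.

Definition slice (u : nat -> nat) (a b : nat) : seq nat :=
  [seq u i | i <- iota a (b - a)].

(* d is a derived word of u with respect to v: pos enumerates increasingly
   all occurrences of v in u (so pos 0 is the first occurrence, and
   u = p r_{s0} r_{s1} ... with r_{s_j} = u[pos j, pos (j+1)) the return
   words), and d codes the return words injectively by letters, the letters
   being 0,...,k (k+1 = number of distinct return words); this is the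
   derived word up to a permutation of letters. *)
Definition derived_word (u : nat -> nat) (v : seq nat) (d : nat -> nat) : Prop :=
  exists pos : nat -> nat,
    (forall j, pos j < pos j.+1) /\
    (forall i, occurs_at u v i <-> exists j, pos j = i) /\
    (forall j j', d j = d j' <->
        slice u (pos j) (pos j.+1) = slice u (pos j') (pos j'.+1)) /\
    (forall a, (exists j, d j = a) <-> (forall b, b <= a -> exists j, d j = b)).

Definition closed_under_derivation (M : seq morph) : Prop :=
  (forall phi, phi \in M -> primitive_substitution phi) /\
  forall phi u v, phi \in M -> fixed_by phi u -> factor u v ->
    exists d psi, derived_word u v d /\ psi \in M /\ fixed_by psi d.

Definition closeable_under_derivation (phi : morph) : Prop :=
  primitive_substitution phi /\
  exists M : seq morph, phi \in M /\ closed_under_derivation M.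

Local Open Scope ring_scope.

(* lower case: I=[0,l0+l1), I0=[0,l0) ; upper case: I=(0,l0+l1], I0=(0,l0] *)
Definition T2_lower (R : realType) (l0 l1 : R) (x : R) : R :=
  if x < l0 then x + l1 else x - l0.
Definition T2_upper (R : realType) (l0 l1 : R) (x : R) : R :=
  if x <= l0 then x + l1 else x - l0.

Definition codes_2iet (R : realType) (l0 l1 rho : R) (u : nat -> nat) : Prop :=
  (0 < l0 /\ 0 < l1) /\
  ( (0 <= rho /\ rho < l0 + l1 /\
     forall n, u n = (if iter n (T2_lower l0 l1) rho < l0 then 0%N else 1%N))
  \/
    (0 < rho /\ rho <= l0 + l1 /\
     forall n, u n = (if iter n (T2_upper l0 l1) rho <= l0 then 0%N else 1%N)) ).

(* Main.v *)
Require Import Defs.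
From HB Require Import structures.
From mathcomp Require Import all_boot all_order all_algebra.
From mathcomp Require Import reals boolp zify lra.
Set Implicit Arguments. Unset Strict Implicit. Unset Printing Implicit Defensive.

(** A coding [x] of a two interval exchange with irrational slope is
    desubstituted forever: with [b] the letter of the longer interval, [x] is
    [L b y] or [~~b L b y], where [L b] maps [b] to [b] and [~~b] to [b ~~b]
    and [y] codes the exchange induced on that interval.  The successive
    letters [b] form the directive sequence of [x]; the words for which the
    second alternative never occurs are the characteristic ones, i.e. the
    codings of [rho = l1].  The iterated desubstitutions of [x] are derived
    words of [x].

    A morphism [f] fixing [x] is a product of morphisms [L b] and of their
    conjugates [R b], with [b] running through the directive sequence, and
    possibly of the letter exchange.  Hence the directive sequence is periodic
    and, up to the letter exchange, some derived word of [x] is a shift of [x],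
    which is a proper shift unless [x] is characteristic.  In a finite closed
    set of substitutions, which has finitely many fixed points, this forces
    some shift of [x] to be a characteristic word [c], say [x = z c]; comparing
    [f] with the product of the corresponding [L b] gives [size z <= 2].

    Conversely, the words [c], [0c], [1c], [01c], [10c] for the finitely many
    shifts of a periodic directive sequence are each fixed by a product of
    [L b]'s and [R b]'s, have their derived words among themselves, and exhaust
    the fixed points of these products. *)

(** * Words and morphisms on two letters *)

Notation word := (nat -> bool).
Notation bmorph := (bool -> seq bool).

Definition shiftw (k : nat) (x : word) : word := fun n => x (k + n).
Definition catw (w : seq bool) (x : word) : word :=
  fun n => if n < size w then nth false w n else x (n - size w).
Infix "+++" := catw (at level 60, right associativity).

Definition ext (f : bmorph) (w : seq bool) : seq bool := flatten [seq f c | c <- w].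
(** A nonerasing [f] maps [n.+1] letters to at least [n.+1] letters, so position [n] is then settled
    and the default [false] is not read. *)
Definition app (f : bmorph) (x : word) : word :=
  fun n => nth false (ext f (mkseq x n.+1)) n.
Definition nonerasing (f : bmorph) := forall c, 0 < size (f c).

Lemma shiftw0 x : shiftw 0 x = x.
Proof. by apply/funext. Qed.

Lemma shiftwD i j x : shiftw i (shiftw j x) = shiftw (j + i) x.
Proof. by apply/funext => n; rewrite /shiftw addnA. Qed.

Lemma catw_nil x : [::] +++ x = x.
Proof. by apply/funext => n; rewrite /catw subn0. Qed.

Lemma catw_cat s t x : (s ++ t) +++ x = s +++ (t +++ x).
Proof.
apply/funext => n; rewrite /catw size_cat nth_cat.
case: (ltnP n (size s)) => h1.
  by case: ifP => //; lia.
have -> : (n - size s < size t) = (n < size s + size t) by lia.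
by case: ifP => // _; congr (x _); lia.
Qed.

Lemma shiftw_catw w x : shiftw (size w) (w +++ x) = x.
Proof.
by apply/funext => n; rewrite /shiftw /catw ltnNge leq_addr /= addKn.
Qed.

Lemma shiftw_catw_ge k w x : size w <= k -> shiftw k (w +++ x) = shiftw (k - size w) x.
Proof.
by move=> h; rewrite -{1}(subnKC h) -shiftwD shiftw_catw.
Qed.

Lemma shiftw1_cons c x : shiftw 1 ([:: c] +++ x) = x.
Proof. exact: (shiftw_catw [:: c]). Qed.

Lemma shiftw_catw_le k w x : k <= size w -> shiftw k (w +++ x) = drop k w +++ x.
Proof.
move=> h; rewrite -{1}(cat_take_drop k w) catw_cat shiftw_catw_ge size_take_min.
  by rewrite (minn_idPl h) subnn shiftw0.
by rewrite geq_minl.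
Qed.

Lemma catw_shiftw n x : mkseq x n +++ shiftw n x = x.
Proof.
apply/funext => i; rewrite /catw size_mkseq; case: ltnP => h.
  by rewrite nth_mkseq.
by rewrite /shiftw subnKC.
Qed.

Lemma catw_shiftw1 x : [:: x 0] +++ shiftw 1 x = x.
Proof. exact: (catw_shiftw 1). Qed.

Lemma catw_cons0 c w x : ((c :: w) +++ x) 0 = c.
Proof. by []. Qed.

Lemma mkseq_catw n w x : mkseq (w +++ x) (size w + n) = w ++ mkseq x n.
Proof.
apply: (@eq_from_nth _ false); first by rewrite size_mkseq size_cat size_mkseq.
move=> i; rewrite size_mkseq => h.
rewrite nth_mkseq // nth_cat /catw; case: ltnP => h' //.
by rewrite nth_mkseq //; lia.
Qed.

Lemma mkseq_catw_size w x : mkseq (w +++ x) (size w) = w.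
Proof. by rewrite -[X in mkseq _ X]addn0 mkseq_catw cats0. Qed.

Lemma mkseqD x m n : mkseq x (m + n) = mkseq x m ++ mkseq (shiftw m x) n.
Proof.
by have := mkseq_catw n (mkseq x m) (shiftw m x); rewrite catw_shiftw size_mkseq.
Qed.

Lemma mkseqS1 x n : mkseq x n.+1 = x 0 :: mkseq (shiftw 1 x) n.
Proof. exact: (mkseqD x 1 n). Qed.

Lemma catw_inj s t x y : size s = size t -> s +++ x = t +++ y -> s = t /\ x = y.
Proof.
move=> h e; split.
  by rewrite -(mkseq_catw_size s x) e h mkseq_catw_size.
by rewrite -(shiftw_catw s x) e h shiftw_catw.
Qed.

Lemma catw_prefix s t x y : s +++ x = t +++ y -> size s <= size t ->
  exists2 u, t = s ++ u & x = u +++ y.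
Proof.
move=> e h; exists (drop (size s) t).
  have e' : s +++ x = take (size s) t +++ (drop (size s) t +++ y).
    by rewrite -catw_cat cat_take_drop.
  have [es _] := catw_inj (esym (size_takel h)) e'.
  by rewrite {1}es cat_take_drop.
by have := congr1 (shiftw (size s)) e; rewrite shiftw_catw shiftw_catw_le.
Qed.

Lemma ext_cat f s t : ext f (s ++ t) = ext f s ++ ext f t.
Proof. by rewrite /ext map_cat flatten_cat. Qed.

Lemma ext_cons f c t : ext f (c :: t) = f c ++ ext f t.
Proof. by []. Qed.

Lemma ext_seq1 f c : ext f [:: c] = f c.
Proof. by rewrite /ext /= cats0. Qed.

Lemma ext_id w : ext (fun c => [:: c]) w = w.
Proof. by elim: w => //= c w IH; rewrite ext_cons IH. Qed.

Lemma ext_comp f g w : ext (ext f \o g) w = ext f (ext g w).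
Proof. by elim: w => //= c w IH; rewrite !ext_cons IH ext_cat. Qed.

Lemma eq_ext f g w : f =1 g -> ext f w = ext g w.
Proof. by move=> e; elim: w => //= c w IH; rewrite !ext_cons IH e. Qed.

Lemma size_ext f w : nonerasing f -> size w <= size (ext f w).
Proof.
move=> h; elim: w => //= c w IH; rewrite ext_cons size_cat.
by have := h c; lia.
Qed.

Lemma nonerasing_comp f g : nonerasing f -> nonerasing g -> nonerasing (ext f \o g).
Proof.
move=> hf hg c /=; apply: leq_trans (size_ext _ hf); exact: hg.
Qed.

Lemma app_cons f x : nonerasing f -> app f x = f (x 0) +++ app f (shiftw 1 x).
Proof.
move=> h; apply/funext => n; rewrite /app mkseqS1 ext_cons nth_cat /catw.
case: ltnP => // hn.
have hs := h (x 0).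
set m := n - _.
have -> : n = m.+1 + (n - m.+1) by rewrite /m; lia.
rewrite mkseqD ext_cat nth_cat.
have := size_ext (mkseq (shiftw 1 x) m.+1) h; rewrite size_mkseq => h2.
by rewrite h2.
Qed.

Lemma app0 f x d : nonerasing f -> app f x 0 = head d (f (x 0)).
Proof. by move=> h; rewrite app_cons //; have := h (x 0); case: (f (x 0)). Qed.

Lemma app_catw f w x : nonerasing f -> app f (w +++ x) = ext f w +++ app f x.
Proof.
move=> h; elim: w x => [|c w IH] x; first by rewrite !catw_nil.
rewrite app_cons // -cat1s catw_cat shiftw1_cons IH cat1s ext_cons catw_cat.
by congr (f _ +++ _).
Qed.

Lemma app_split f x n : nonerasing f ->
  app f x = ext f (mkseq x n) +++ app f (shiftw n x).
Proof. by move=> h; rewrite -app_catw // catw_shiftw. Qed.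

(** A coinduction principle: [Q] acts as a bisimulation, and each unfolding settles at least one
    more letter because [f] is nonerasing. *)
Lemma app_unique f (Q : word -> word -> Prop) : nonerasing f ->
  (forall x y, Q x y -> exists x', x = f (y 0) +++ x' /\ Q x' (shiftw 1 y)) ->
  forall x y, Q x y -> x = app f y.
Proof.
move=> h hQ x y q; apply/funext => n.
elim/ltn_ind: n x y q => n IH x y q.
have [x' [-> q']] := hQ _ _ q.
rewrite app_cons // /catw; case: ltnP => // hn.
by apply: IH q'; have := h (y 0); lia.
Qed.

Lemma app_comp f g x : nonerasing f -> nonerasing g ->
  app (ext f \o g) x = app f (app g x).
Proof.
move=> hf hg; apply/esym.
apply: (app_unique (Q := fun X Y => X = app f (app g Y))) => //.
  exact: nonerasing_comp.
move=> X Y ->; exists (app f (app g (shiftw 1 Y))); split=> //.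
by rewrite (app_cons Y hg) app_catw.
Qed.

Lemma eq_app f g x : f =1 g -> app f x = app g x.
Proof. by move=> e; apply/funext => n; rewrite /app (eq_ext _ e). Qed.

Lemma app_id x : app (fun c => [:: c]) x = x.
Proof. by apply/funext => n; rewrite /app ext_id nth_mkseq. Qed.

(** * The elementary Sturmian morphisms [L], [R] and their conjugacy *)

Definition L (b : bool) : bmorph := fun c => if c == b then [:: b] else [:: b; c].
Definition R (b : bool) : bmorph := fun c => if c == b then [:: b] else [:: c; b].

Lemma nonerasing_L b : nonerasing (L b).
Proof. by move=> c; rewrite /L; case: ifP. Qed.

Lemma nonerasing_R b : nonerasing (R b).
Proof. by move=> c; rewrite /R; case: ifP. Qed.

#[local] Hint Resolve nonerasing_L nonerasing_R : core.

Lemma cons_R b c : b :: R b c = L b c ++ [:: b].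
Proof. by rewrite /R /L; case: eqP. Qed.

Lemma cons_ext_R b w : b :: ext (R b) w = ext (L b) w ++ [:: b].
Proof.
elim: w => //= c w IH.
by rewrite !ext_cons -catA -IH -cat1s catA cat1s cons_R -catA.
Qed.

Lemma app_LR b x : app (L b) x = [:: b] +++ app (R b) x.
Proof.
apply/esym; apply: (app_unique (Q := fun X Y => X = [:: b] +++ app (R b) Y)) => //.
move=> X Y ->; exists ([:: b] +++ app (R b) (shiftw 1 Y)); split=> //.
by rewrite (app_cons Y (nonerasing_R b)) -!catw_cat -cons_R.
Qed.

Lemma app_R0 b x : app (R b) x 0 = x 0.
Proof. by rewrite app_cons // /R; case: eqP => [->|]. Qed.

Lemma app_L0 b x : app (L b) x 0 = b.
Proof. by rewrite app_LR. Qed.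

Lemma app_L1 b x : app (L b) x 1 = x 0.
Proof. by rewrite app_LR -[LHS]/(app (R b) x 0) app_R0. Qed.

Lemma app_L_inj b x y : app (L b) x = app (L b) y -> x = y.
Proof.
move=> e; apply/funext => n; elim: n x y e => [|n IH] x y e.
  by rewrite -(app_L1 b x) e app_L1.
have e0 : x 0 = y 0 by rewrite -(app_L1 b x) e app_L1.
move: e; rewrite (app_cons x) // (app_cons y) // e0 => e.
have [_ e'] := catw_inj erefl e.
exact: (IH (shiftw 1 x) (shiftw 1 y)).
Qed.

(** Each image of a letter contains [b] exactly once, so counting [b] recovers the length; padding
    then reduces the claim to infinite words. *)
Lemma ext_L_inj b : injective (ext (L b)).
Proof.
move=> s t e.
have h : app (L b) (s +++ fun=> b) = app (L b) (t +++ fun=> b).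
  by rewrite !app_catw // e.
have h2 := app_L_inj h.
have hc v : count (pred1 b) (ext (L b) v) = size v.
  elim: v => //= c v IH; rewrite ext_cons count_cat IH /L.
  by case: (c =P b) => /=; rewrite eqxx //; case: (c) (b) => [] [].
have hs : size s = size t by rewrite -!hc e.
by have [] := catw_inj hs h2.
Qed.

(** A cut inside an image can only separate the two letters of [[:: b; ~~ b]]; then [e.+1] is the
    next block boundary. *)
Lemma shiftw_app_L b x e :
  exists j, (e = size (ext (L b) (mkseq x j)) /\ shiftw e (app (L b) x) = app (L b) (shiftw j x))
   \/ (0 < j /\ e.+1 = size (ext (L b) (mkseq x j)) /\
       shiftw e (app (L b) x) = [:: ~~ b] +++ app (L b) (shiftw j x)).
Proof.
have cut j : shiftw (size (ext (L b) (mkseq x j))) (app (L b) x) = app (L b) (shiftw j x).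
  by rewrite (app_split x j) // shiftw_catw.
elim: e => [|e [j [[he hs]|[hj [he hs]]]]].
- by exists 0; left; rewrite !shiftw0.
- have hS : mkseq x j.+1 = mkseq x j ++ [:: x j] by rewrite -addn1 mkseqD /mkseq /= /shiftw addn0.
  exists j.+1; case: (x j =P b) => hxj.
    left; have hz : e.+1 = size (ext (L b) (mkseq x j.+1)).
      by rewrite hS ext_cat size_cat -he ext_seq1 /L hxj eqxx addn1.
    by split=> //; rewrite hz cut.
  right; have hb : x j = ~~ b by case: (x j) (b) hxj => [] [].
  split=> //; split.
    by rewrite hS ext_cat size_cat -he ext_seq1 /L; case: eqP => // _; rewrite addn2.
  rewrite -addn1 -shiftwD hs (app_cons _ (nonerasing_L b)) /shiftw addn0.
  rewrite /L; case: eqP => // _; rewrite hb -[[:: b; ~~ b]]/([:: b] ++ [:: ~~ b]) catw_cat.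
  rewrite -[LHS]/(shiftw 1 _) shiftw1_cons; congr (_ +++ app _ _).
  by apply/funext => n; congr (x _); lia.
- by exists j; left; split=> //; rewrite he cut.
Qed.

(** * Directive sequences *)

(* [U n.+1] codes the return words of the letter [a n] in [U n]; the second
   alternative is the one where [U n] does not start with that letter. *)
Definition dseq (a : word) (U : nat -> word) := forall n,
  U n = app (L (a n)) (U n.+1) \/ U n = [:: ~~ a n] +++ app (L (a n)) (U n.+1).
Definition charseq (a : word) (U : nat -> word) := forall n, U n = app (L (a n)) (U n.+1).
(** For codings this is what irrationality of the slope becomes; it forces both letters to occur and
    the words to be aperiodic. *)
Definition both_io (a : word) := forall n b, exists m, n <= m /\ a m = b.

Lemma charseq_dseq a U : charseq a U -> dseq a U.
Proof. by move=> h n; left. Qed.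

Lemma dseq_shift k a U : dseq a U -> dseq (shiftw k a) (fun n => U (k + n)).
Proof. by move=> h n; have := h (k + n); rewrite addnS. Qed.

Lemma charseq_shift k a U : charseq a U -> charseq (shiftw k a) (fun n => U (k + n)).
Proof. by move=> h n; have := h (k + n); rewrite addnS. Qed.

Lemma both_io_shift k a : both_io a -> both_io (shiftw k a).
Proof.
move=> h n b; have [m [hm <-]] := h (k + n) b; exists (m - k); split; first lia.
by rewrite /shiftw subnKC //; lia.
Qed.

(** The first letter tells the two alternatives apart, since [app (L b) y] begins with [b]. *)
Lemma desubst_inj b x y y' :
  (x = app (L b) y \/ x = [:: ~~ b] +++ app (L b) y) ->
  (x = app (L b) y' \/ x = [:: ~~ b] +++ app (L b) y') -> y = y'.
Proof.
move=> [->|->] [] e.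
- exact: app_L_inj e.
- by have := congr1 (fun z => z 0) e; rewrite app_L0 catw_cons0; case: (b).
- by have := congr1 (fun z => z 0) e; rewrite app_L0 catw_cons0; case: (b).
- by have [_ e'] := catw_inj erefl e; apply: app_L_inj e'.
Qed.

Lemma desubst_shift b x y e :
  x = app (L b) y \/ x = [:: ~~ b] +++ app (L b) y ->
  exists e', shiftw e x = app (L b) (shiftw e' y) \/
             shiftw e x = [:: ~~ b] +++ app (L b) (shiftw e' y).
Proof.
move=> [->|->].
  by have [j [[_ h]|[_ [_ h]]]] := shiftw_app_L b y e; exists j; [left|right].
case: e => [|e]; first by exists 0; right; rewrite !shiftw0.
rewrite -add1n -shiftwD shiftw1_cons.
by have [j [[_ h]|[_ [_ h]]]] := shiftw_app_L b y e; exists j; [left|right].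
Qed.

(** Directive sequences do not see shifts: a shift at one level induces a shift at the next, and [E]
    collects the induced amounts. *)
Lemma dseq_tail a U e : dseq a U -> exists2 V, dseq a V & V 0 = shiftw e (U 0).
Proof.
move=> hU.
have step (p : nat * nat) : exists e',
    shiftw p.2 (U p.1) = app (L (a p.1)) (shiftw e' (U p.1.+1)) \/
    shiftw p.2 (U p.1) = [:: ~~ a p.1] +++ app (L (a p.1)) (shiftw e' (U p.1.+1)).
  exact: desubst_shift (hU p.1).
have [g hg] := choice step.
pose E := fix E n := if n is m.+1 then g (m, E m) else e.
exists (fun n => shiftw (E n) (U n)) => // n.
exact: (hg (n, E n)).
Qed.

Lemma app_L_nodouble b y n : app (L b) y n = ~~ b -> app (L b) y n.+1 = b.
Proof.
have e0 x k : x k = shiftw k x 0 by rewrite /shiftw addn0.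
have e1 x k : x k.+1 = shiftw k x 1 by rewrite /shiftw addn1.
rewrite e0 e1; have [j [[_ ->]|[_ [_ ->]]]] := shiftw_app_L b y n.
  by rewrite app_L0; case: (b).
by move=> _; rewrite /catw /= app_L0.
Qed.

Lemma dseq_nodouble a U n i : dseq a U -> U n i = ~~ a n -> U n i.+1 = a n.
Proof.
move=> h; case: (h n) => ->; first exact: app_L_nodouble.
case: i => [|i]; first by rewrite /catw /= app_L0.
by rewrite /catw /= !subn1 /=; apply: app_L_nodouble.
Qed.

Lemma app_L_letter b y i :
  app (L b) y (size (ext (L b) (mkseq y i))) = b /\
  app (L b) y (size (ext (L b) (mkseq y i))).+1 = y i.
Proof.
rewrite (app_split y i) //; set w := ext _ _; split.
  by rewrite -[size w]addn0 -[LHS]/(shiftw (size w) _ 0) shiftw_catw app_L0.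
by rewrite -addn1 -[LHS]/(shiftw (size w) _ 1) shiftw_catw app_L1 /shiftw addn0.
Qed.

Lemma dseq_double a U n i : dseq a U -> U n.+1 i = a n ->
  exists j, U n j = a n /\ U n j.+1 = a n.
Proof.
move=> h hi; have [e1 e2] := app_L_letter (a n) (U n.+1) i; rewrite hi in e2.
case: (h n) => ->; [by eexists; split; [exact: e1|] | exists (size (ext (L (a n)) (mkseq (U n.+1) i))).+1].
by rewrite /catw /= subn1.
Qed.

Lemma dseq_letter a U (ha : both_io a) (hU : dseq a U) n b : exists i, U n i = b.
Proof.
have [m [hm hb]] := ha n b.
have [k hk] : exists k, k = m - n by exists (m - n).
elim: k n hm hk => [|k IH] n hm hk.
  have {hm hk} hn : n = m by lia.
  subst m; case: (hU n) => ->.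
    by exists 0; rewrite app_L0.
  by exists 1; rewrite /catw /= app_L0.
have [|| i hi] := IH n.+1; try lia.
have [_ e] := app_L_letter (a n) (U n.+1) i.
case: (hU n) => ->; first by eexists; rewrite -hi; exact: e.
by eexists (_.+2); rewrite -hi /catw /= subn1; exact: e.
Qed.

Lemma dseq_letter_io a U n k b : both_io a -> dseq a U -> exists2 i, k <= i & U n i = b.
Proof.
move=> ha hU.
have [V hV e] := dseq_tail k (dseq_shift n hU).
have [i hi] := dseq_letter (both_io_shift n ha) hV 0 b.
exists (k + i); first exact: leq_addr.
by move: hi; rewrite e addn0.
Qed.

(** The letter [a n] can be read off [U n]: it occurs twice in a row there, whereas [~~ a n] never
    does. *)
Lemma dseq_unique a U a' U' : both_io a -> both_io a' -> dseq a U -> dseq a' U' ->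
  U 0 = U' 0 -> forall n, U n = U' n /\ a n = a' n.
Proof.
move=> ha ha' hU hU' e0.
have step n : U n = U' n -> a n = a' n.
  move=> e; apply/eqP; apply/negPn/negP => hne.
  have [i hi] := dseq_letter ha hU n.+1 (a n).
  have [j [h1 h2]] := dseq_double hU hi.
  have hb : a n = ~~ a' n by case: (a n) (a' n) hne => [] [].
  have := dseq_nodouble (i := j) hU' (n := n); rewrite -e h1 h2 hb => /(_ erefl).
  by case: (a' n).
elim=> [|n [IHU IHa]]; first by split=> //; exact: step.
suff e : U n.+1 = U' n.+1 by split=> //; apply: step.
apply: (@desubst_inj (a n) (U n)); first exact: hU.
by rewrite IHU IHa; apply: hU'.
Qed.

(** Descent on the period. A tail starting with [a 0] is an exact [L] image, its period ends at a
    block boundary, and so [V 1] has a period [j], which is smaller unless [V 1] is constant. *)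
Lemma dseq_aperiodic_aux a U p : both_io a -> dseq a U -> 0 < p -> shiftw p (U 0) = U 0 -> False.
Proof.
elim/ltn_ind: p a U => p IH a U ha hU hp e.
have [i hi] := dseq_letter ha hU 0 (a 0).
have [V hV eV] := dseq_tail i hU.
have V0 : V 0 0 = a 0 by rewrite eV /shiftw addn0.
have e' : shiftw p (V 0) = V 0 by rewrite eV shiftwD addnC -shiftwD e.
case: (hV 0) => eL; last by move: V0; rewrite eL; case: (a 0).
have [j [[hj hs]|[_ [_ hs]]]] := shiftw_app_L (a 0) (V 1) p; last first.
  by move: V0; rewrite -e' eL hs; case: (a 0).
have eV1 : shiftw j (V 1) = V 1 by apply: (@app_L_inj (a 0)); rewrite -hs -eL.
have hc w : size (ext (L (a 0)) w) = size w + count (pred1 (~~ a 0)) w.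
  elim: w => //= c w IHw; rewrite ext_cons size_cat IHw /L.
  by case: c (a 0) => [] [] /=; lia.
move: hj; rewrite hc size_mkseq => hj.
have hj0 : 0 < j by case: j hj {hs eV1} => //=; lia.
case: (posnP (count (pred1 (~~ a 0)) (mkseq (V 1) j))) => hcnt; last first.
  apply: (IH j _ _ _ (both_io_shift 1 ha) (dseq_shift 1 hV)) => //; lia.
(* Here [j = p]: the period of [V 1] contains only the letter [a 0], so [V 1] is constant. *)
have hall m : V 1 m = a 0.
  elim/ltn_ind: m => m IHm; case: (ltnP m j) => hm.
    apply/eqP/negPn/negP => hne; move: hcnt; apply/eqP; rewrite -lt0n -has_count.
    apply/hasP; exists (V 1 m); first by apply/mapP; exists m => //; rewrite mem_iota.
    by move: hne; rewrite /=; case: (V 1 m) (a 0) => [] [].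
  by rewrite -(subnKC hm) -[V 1 _]/(shiftw j (V 1) _) eV1; apply: IHm; lia.
by have [m] := dseq_letter ha hV 1 (~~ a 0); rewrite hall; case: (a 0).
Qed.

Lemma dseq_aperiodic a U i j : both_io a -> dseq a U ->
  shiftw i (U 0) = shiftw j (U 0) -> i = j.
Proof.
move=> ha hU.
wlog hij : i j / i < j.
  move=> H; case: (ltngtP i j) => //; first exact: H.
  by move=> h e; apply/esym; apply: H.
move=> e; exfalso.
have [V hV eV] := dseq_tail i hU.
apply: (@dseq_aperiodic_aux a V (j - i)) => //; first lia.
by rewrite eV shiftwD subnKC // ltnW.
Qed.

(** * Sturmian morphisms *)

Definition LR (r : bool) : bool -> bmorph := if r then R else L.

(** General products of elementary morphisms: each flag chooses between [L] and its conjugate [R]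
    for the next directive letter, and [p] records an innermost letter exchange. *)
Fixpoint sig (a : word) (s : seq bool) (p : bool) : bmorph :=
  if s is r :: s' then ext (LR r (a 0)) \o sig (shiftw 1 a) s' p
  else fun c => [:: c (+) p].
Definition lsig a k p := sig a (nseq k false) p.
(** The conjugating word between the pure [L] product and [sig a s p], as made precise in
    [app_lsig_sig]. *)
Fixpoint pfx (a : word) (s : seq bool) : seq bool :=
  if s is r :: s' then ext (L (a 0)) (pfx (shiftw 1 a) s') ++ nseq r (a 0) else [::].
(** The central (bispecial) word. A pure [R] product keeps first letters up to the exchange, so this
    is the longest common prefix of all words [app (lsig a k p) X]. *)
Definition bisp a k := pfx a (nseq k true).
Definition flip (p : bool) (x : word) : word := fun n => x n (+) p.

Lemma nonerasing_LR r b : nonerasing (LR r b).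
Proof. by case: r. Qed.

#[local] Hint Resolve nonerasing_LR : core.

Lemma nonerasing_sig a s p : nonerasing (sig a s p).
Proof.
by elim: s a => [|r s IH] a //; apply: nonerasing_comp.
Qed.

#[local] Hint Resolve nonerasing_sig : core.

Lemma nonerasing_lsig a k p : nonerasing (lsig a k p).
Proof. exact: nonerasing_sig. Qed.

#[local] Hint Resolve nonerasing_lsig : core.

Lemma app_flip p x : app (fun c => [:: c (+) p]) x = flip p x.
Proof.
apply/esym; apply: (app_unique (Q := fun X Y => X = flip p Y)) => // X Y ->.
exists (flip p (shiftw 1 Y)); split=> //.
by rewrite -{1}(catw_shiftw1 Y); apply/funext => -[].
Qed.

Lemma flipK p x : flip p (flip p x) = x.
Proof. by apply/funext => n; rewrite /flip addbK. Qed.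

Lemma flip_flip p q x : flip p (flip q x) = flip (p (+) q) x.
Proof. by apply/funext => n; rewrite /flip -addbA (addbC q). Qed.

Lemma flip0 x : flip false x = x.
Proof. by apply/funext => n; rewrite /flip addbF. Qed.

Lemma flip_shiftw p k x : flip p (shiftw k x) = shiftw k (flip p x).
Proof. by []. Qed.

Lemma flip_app_L p b x : flip p (app (L b) x) = app (L (b (+) p)) (flip p x).
Proof.
apply: (app_unique (Q := fun X Y => X = flip p (app (L b) (flip p Y)))) => //; last first.
  by rewrite flipK.
move=> X Y ->; exists (flip p (app (L b) (flip p (shiftw 1 Y)))); split=> //.
rewrite app_cons // flip_shiftw; move: (app _ (shiftw _ _)) => Z.
apply/funext => n; rewrite /catw /flip /L.
by case: (Y 0) b p => [] [] [] /=; case: n => [|[|n]].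
Qed.

Lemma dseq_flip p a U : dseq a U -> dseq (flip p a) (fun n => flip p (U n)).
Proof.
move=> h n; case: (h n) => e; [left|right]; rewrite {1}e.
  by rewrite flip_app_L.
rewrite -flip_app_L; apply/funext => -[|i]; rewrite /flip /catw //=.
by rewrite addNb.
Qed.

Lemma both_io_flip p a : both_io a -> both_io (flip p a).
Proof.
move=> h n b; have [m [hm e]] := h n (b (+) p); exists m; split=> //.
by rewrite /flip e addbK.
Qed.

Lemma app_lsig_sig a s p X : app (lsig a (size s) p) X = pfx a s +++ app (sig a s p) X.
Proof.
elim: s a => [|r s IH] a; first by rewrite catw_nil.
rewrite /lsig /= !app_comp // -/(lsig _ _ _) IH app_catw // catw_cat.
by case: r => //=; rewrite ?catw_nil // app_LR.
Qed.

Lemma app_lsig a k p X : app (lsig a k p) X = bisp a k +++ app (sig a (nseq k true) p) X.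
Proof. by rewrite -app_lsig_sig size_nseq. Qed.

Lemma app_rsig0 a k p X : app (sig a (nseq k true) p) X 0 = X 0 (+) p.
Proof.
elim: k a => [|k IH] a; first by rewrite app_flip.
by rewrite /= app_comp // app_R0 IH.
Qed.

Definition cnt (c : bool) (w : seq bool) : nat := count_mem c w.

Lemma cnt_cons c d w : cnt c (d :: w) = (d == c) + cnt c w.
Proof. by []. Qed.

Lemma cnt_cat c s t : cnt c (s ++ t) = cnt c s + cnt c t.
Proof. exact: count_cat. Qed.

Lemma count_L (b : bool) w : cnt b (ext (L b) w) = size w.
Proof.
elim: w => //= c w IH; rewrite ext_cons cnt_cat IH /L.
by case: c b {IH} => [] [].
Qed.

Lemma count_LN (b : bool) w : cnt (~~ b) (ext (L b) w) = cnt (~~ b) w.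
Proof.
elim: w => //= c w IH; rewrite ext_cons cnt_cat IH /L.
by case: c b {IH} => [] [].
Qed.

Lemma size_count (b : bool) w : size w = cnt b w + cnt (~~ b) w.
Proof. by elim: w => //= c w ->; case: c b => [] [] /=; lia. Qed.

Lemma size_ext_count f w :
  size (ext f w) = cnt false w * size (f false) + cnt true w * size (f true).
Proof.
elim: w => //= c w IH; rewrite ext_cons size_cat IH.
by case: c => /=; lia.
Qed.

Lemma count_L_sum (b c : bool) w : cnt c (ext (L b) w) =
  (c == b) * cnt (~~ b) w + cnt c w.
Proof.
case: (c =P b) => [->|h].
  by rewrite count_L (size_count b) mul1n addnC.
have -> : c = ~~ b by case: c b h => [] [].
by rewrite count_LN.
Qed.

(** Stated letter by letter because [L] acts monotonically on the pair of letter counts, while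
    lengths alone do not determine the lengths of images. *)
Lemma count_pfx a s (c : bool) : cnt c (pfx a s) <= cnt c (bisp a (size s)).
Proof.
elim: s a c => [|r s IH] a c //=.
rewrite /bisp /= !cnt_cat !count_L_sum -/(bisp _ _).
have h1 := IH (shiftw 1 a) (~~ a 0); have h2 := IH (shiftw 1 a) c.
by case: r => /=; rewrite ?cnt_cons ?[a 0 == c]eq_sym; case: (c == a 0) => /=; lia.
Qed.

Lemma size_pfx a s : size (pfx a s) <= size (bisp a (size s)).
Proof.
rewrite (size_count true (pfx _ _)) (size_count true (bisp _ _)).
by apply: leq_add; apply: count_pfx.
Qed.

(** The classical relation between a standard pair and its central word: the two images together
    have the letters of the central word and one further letter of each kind. *)
Lemma count_lsig a k p (c : bool) :
  cnt c (lsig a k p false) + cnt c (lsig a k p true) = (cnt c (bisp a k)).+1.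
Proof.
elim: k a c => [|k IH] a c; first by case: p c => [] [].
rewrite /lsig /= !count_L_sum -!/(lsig _ _ _) /bisp /= cnt_cat count_L_sum -/(bisp _ _) /=.
have h1 := IH (shiftw 1 a) (~~ a 0); have h2 := IH (shiftw 1 a) c.
by rewrite ?cnt_cons [a 0 == c]eq_sym; case: (c == a 0) => /=; lia.
Qed.

Lemma size_ext_lsig f a k p :
  size (ext f (lsig a k p false)) + size (ext f (lsig a k p true)) =
  size (ext f (bisp a k)) + size (f false) + size (f true).
Proof.
rewrite !size_ext_count.
have h1 := count_lsig a k p false; have h2 := count_lsig a k p true.
nia.
Qed.

Lemma size_lsig a k p :
  size (lsig a k p false) + size (lsig a k p true) = (size (bisp a k)).+2.
Proof.
by have := size_ext_lsig (fun c => [:: c]) a k p; rewrite !ext_id /= !addn1.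
Qed.

Lemma count_LR (r b : bool) d w : cnt d (ext (LR r b) w) = cnt d (ext (L b) w).
Proof.
elim: w => //= e w IH; rewrite !ext_cons !cnt_cat IH; congr (_ + _).
by rewrite {IH}; case: r => //=; rewrite /R /L; case: eqP => // _; rewrite !cnt_cons addnCA.
Qed.

Lemma size_sig a s p c : size (sig a s p c) = size (lsig a (size s) p c).
Proof.
suff h (d : bool) : cnt d (sig a s p c) = cnt d (lsig a (size s) p c).
  by rewrite (size_count true (sig _ _ _ _)) (size_count true (lsig _ _ _ _)) !h.
elim: s a d => [|r s IH] a d //=.
by rewrite /lsig /= count_LR !count_L_sum -/(lsig _ _ _) !IH.
Qed.

Lemma mem_ext_LR r b c w : c \in w -> c \in ext (LR r b) w.
Proof.
move=> h; apply/flattenP; exists (LR r b c); first exact: map_f.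
by case: r; rewrite /= /R /L; case: eqP => [->|_]; rewrite !inE eqxx ?orbT.
Qed.

Lemma mem_ext_LR_head r b w : 0 < size w -> b \in ext (LR r b) w.
Proof.
case: w => // c w _; rewrite ext_cons mem_cat.
by case: r; rewrite /= /R /L; case: eqP => _; rewrite !inE eqxx ?orbT.
Qed.

Lemma mem_sig_dir a s p c i : i < size s -> a i \in sig a s p c.
Proof.
elim: s a i => //= r s IH a [|i] h.
  by apply: mem_ext_LR_head; apply: nonerasing_sig.
by apply: mem_ext_LR; apply: (IH (shiftw 1 a) i).
Qed.

Lemma mem_lsig a k c : c \in lsig a k false c.
Proof.
rewrite /lsig; elim: k a => [|k IH] a /=; first by rewrite addbF inE.
by apply: (@mem_ext_LR false).
Qed.

Lemma lsigD a k j p c :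
  lsig a (k + j) p c = ext (lsig a k false) (lsig (shiftw k a) j p c).
Proof.
elim: k a => [|k IH] a.
  rewrite shiftw0 -[LHS]ext_id; apply: eq_ext => d /=; rewrite /lsig /=.
  by rewrite addbF.
rewrite addSn /lsig /= -!/(lsig _ _ _) IH shiftwD.
by rewrite -(ext_comp (L (a 0)) (lsig (shiftw 1 a) k false)).
Qed.

Lemma size_ext_mem f c w : c \in w -> size (f c) <= size (ext f w).
Proof.
by move=> /splitPr [s t]; rewrite ext_cat ext_cons !size_cat; lia.
Qed.

Lemma lsig_mono a k j p : size (lsig a k false p) <= size (lsig a (k + j) false p).
Proof. by rewrite lsigD; apply/size_ext_mem/mem_lsig. Qed.

Lemma bisp_mono a k j : k <= j -> size (bisp a k) <= size (bisp a j).
Proof.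
move=> h; have := lsig_mono a k (j - k) false; have := lsig_mono a k (j - k) true.
by rewrite subnKC //; have := size_lsig a k false; have := size_lsig a j false; lia.
Qed.

Lemma size_ge2 (w : seq bool) : false \in w -> true \in w -> 1 < size w.
Proof. by case: w => [|c [|d w]] //; rewrite !inE; case: c. Qed.

Lemma lsig_growth a N : both_io a -> exists K, forall k, K <= k -> forall c, N <= size (lsig a k false c).
Proof.
elim: N a => [|N IH] a ha; first by exists 0.
have [m0 [_ e0]] := ha 0 false; have [m1 [_ e1]] := ha 0 true.
(* Beyond one occurrence of each letter every image contains both letters, so this block of the
   product at least doubles lengths. *)
pose k1 := (m0 + m1).+1.
have hk d : 1 < size (lsig a k1 false d).
  apply: size_ge2.
    by rewrite -{1}e0; apply: mem_sig_dir; rewrite size_nseq /k1; lia.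
  by rewrite -{1}e1; apply: mem_sig_dir; rewrite size_nseq /k1; lia.
have [K hK] := IH _ (both_io_shift k1 ha).
exists (k1 + K) => k h c.
rewrite -(subnKC (leq_trans (leq_addr K k1) h)) lsigD.
have := hK (k - k1); rewrite leq_subRL => [/(_ h c)|]; last by lia.
set w := lsig _ _ _ c => hw.
have hw0 : 0 < size w by apply: nonerasing_lsig.
have : 2 * size w <= size (ext (lsig a k1 false) w).
  rewrite size_ext_count (size_count false w); have := hk false; have := hk true.
  by rewrite /=; nia.
lia.
Qed.

Lemma bisp_growth a N : both_io a -> exists K, forall k, K <= k -> N <= size (bisp a k).
Proof.
move=> ha; have [K hK] := lsig_growth N.+2 ha; exists K => k hk.
by have := size_lsig a k false; have := hK k hk false; lia.
Qed.

Lemma charseq_lsig a U k : charseq a U -> U 0 = app (lsig a k false) (U k).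
Proof.
elim: k a U => [|k IH] a U h; first by rewrite app_flip flip0.
rewrite /lsig /= app_comp // -/(lsig _ _ _).
by rewrite -(IH _ _ (charseq_shift 1 h)); apply: h.
Qed.

(** Both words begin with every [bisp a k], and these depend on [a] only and grow without bound. *)
Lemma charseq_unique a U V : both_io a -> charseq a U -> charseq a V -> U 0 = V 0.
Proof.
move=> ha hU hV; apply/funext => n.
have [K /(_ K (leqnn K)) hK] := bisp_growth n.+1 ha.
by rewrite (charseq_lsig K hU) (charseq_lsig K hV) !app_lsig /catw hK.
Qed.

(** Only the directive sequences are recorded, not the words: stripping a factor [R] from [f]
    replaces the words by shifts. *)
Definition maps (a a' : word) (f : bmorph) := exists U V,
  [/\ dseq a U, dseq a' V & V 0 = app f (U 0)].

Definition one_of (b : bool) : rel bool := fun c d => (c == b) || (d == b).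

(** Without two consecutive [~~ b], a word starting with [b] splits into blocks [[:: b]] and
    [[:: b; ~~ b]]. *)
Lemma parse_L b w : sorted (one_of b) w -> head b w = b -> exists v, w = ext (L b) v.
Proof.
have [n] := ubnP (size w); elim: n w => // n IH [|c [|d w]] /= hn hs hb.
- by exists [::].
- by exists [:: b]; rewrite hb /ext /L /= eqxx.
- rewrite hb in hs *; case/andP: hs => _ hs; case: (d =P b) => hd.
    have [v hv] := IH (d :: w) hn hs hd.
    by exists (b :: v); rewrite ext_cons -hv /L eqxx.
  have [||| v ->] := IH w; first by lia.
  - exact: path_sorted hs.
  - by case: w hs {hn} => //= e w /andP [] /orP [] /eqP.
  by exists (d :: v); rewrite ext_cons /L; case: (d =P b).
Qed.

(** By conjugacy: put [b] in front, remove the final [b], and parse the result by [L]. *)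
Lemma parse_R b w : sorted (one_of b) w -> last b w = b -> exists v, w = ext (R b) v.
Proof.
case/lastP: w => [|w c]; first by exists [::].
rewrite last_rcons => hs e; rewrite e {c e} in hs *.
have [|| v hv] := @parse_L b (b :: w) => //.
  case: w hs => //= c w hs; rewrite /one_of eqxx /=.
  by move: hs; rewrite rcons_path => /andP [].
exists v; suff [->] : b :: rcons w b = b :: ext (R b) v by [].
by rewrite cons_ext_R -hv -cats1.
Qed.

Lemma sorted_factor a V k n : dseq a V -> sorted (one_of (a 0)) (mkseq (shiftw k (V 0)) n).
Proof.
move=> hV; apply/(sortedP false) => i; rewrite size_mkseq => hi.
rewrite !nth_mkseq //; last by lia.
rewrite /one_of /shiftw addnS; case: (boolP (V 0 (k + i) == a 0)) => //= h.
apply/eqP; apply: (dseq_nodouble hV).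
by case: (V 0 (k + i)) (a 0) h => [] [].
Qed.

(** Used to forbid images whose junction would produce a repeated letter that the target directive
    sequence excludes. *)
Lemma app_joint f x i : nonerasing f ->
  exists k, app f x k = last false (f (x i)) /\ app f x k.+1 = head false (f (x i.+1)).
Proof.
move=> hf; have h1 := hf (x i); have h2 := hf (x i.+1).
pose w := ext f (mkseq x i).
exists (size w + (size (f (x i))).-1).
have e : app f x = (w ++ f (x i)) +++ (f (x i.+1) +++ app f (shiftw i.+2 x)).
  rewrite (app_split x i) // catw_cat (app_cons _ hf) /shiftw addn0.
  congr (_ +++ (_ +++ _)); rewrite (app_cons _ hf).
  congr (f (x _) +++ app f _); first by lia.
  by apply/funext => n; congr (x _); lia.
rewrite e /catw size_cat; split.
  have -> : size w + (size (f (x i))).-1 < size w + size (f (x i)) by lia.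
  rewrite nth_cat ifF; last by lia.
  by rewrite addKn nth_last; case: (f (x i)) h1.
rewrite -addnS prednK // ltnn subnn h2.
by case: (f (x i.+1)) h2.
Qed.

Lemma maps_factor a a' f U V c : both_io a -> nonerasing f -> dseq a U -> dseq a' V ->
  V 0 = app f (U 0) -> exists k, f c = mkseq (shiftw k (V 0)) (size (f c)).
Proof.
move=> ha hf hU hV e.
have [i <-] := dseq_letter ha hU 0 c.
exists (size (ext f (mkseq (U 0) i))).
rewrite e (app_split (U 0) i) // shiftw_catw (app_cons _ hf) /shiftw addn0.
by rewrite mkseq_catw_size.
Qed.

Lemma last_ext f w : nonerasing f -> 0 < size w ->
  last false (ext f w) = last false (f (last false w)).
Proof.
move=> hf; case/lastP: w => // w c _; rewrite last_rcons -cats1 ext_cat ext_seq1.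
by rewrite last_cat; have := hf c; case: (f c).
Qed.

Lemma last_lsig a k c : last false (lsig a k false c) = c.
Proof.
elim: k a => [|k IH] a; first by rewrite /lsig /= addbF.
rewrite /lsig /= -/(lsig _ _ _) last_ext //; last exact: nonerasing_lsig.
by rewrite IH /L; case: eqP.
Qed.

Lemma maps_stripL a a' b f h : nonerasing h ->
  b = a' 0 -> f =1 ext (L b) \o h ->
  maps a a' f -> maps a (shiftw 1 a') h.
Proof.
move=> hh -> hf [U [V [hU hV e]]].
exists U, (fun n => V (1 + n)); split=> //.
apply/esym/(@desubst_inj (a' 0) (V 0)); last exact: hV.
by left; rewrite e (eq_app _ hf) app_comp.
Qed.

(** An [R] image is an [L] image without its first letter, and this makes [V 1] the image
    [app h (U 0)] without its first letter. *)
Lemma maps_stripR a a' b f h : nonerasing h ->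
  b = a' 0 -> f =1 ext (R b) \o h ->
  maps a a' f -> maps a (shiftw 1 a') h.
Proof.
move=> hh -> hf [U [V [hU hV e]]].
have e1 : V 1 = shiftw 1 (app h (U 0)).
  have [j hj] : exists j, j = app h (U 0) 0 by eexists.
  apply: (@desubst_inj (a' 0) (V 0)); first exact: hV.
  rewrite e (eq_app _ hf) app_comp // (app_cons _ (nonerasing_R (a' 0))) -hj.
  rewrite app_LR /R; case: eqP => hne; [left|right] => //.
  rewrite -catw_cat; congr (_ +++ _).
  by case: j (a' 0) hne {hj} => [] [].
(* A full image under [h] is restored by dropping the first letter of [U 0] and what is left of its
   image. *)
have [U' hU' eU] := dseq_tail 1 hU.
have [V' hV' eV] := dseq_tail (size (h (U 0 0)) - 1) (dseq_shift 1 hV).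
exists U', V'; split=> //; rewrite eV eU addn0 e1 shiftwD (app_cons _ hh).
have := hh (U 0 0) => ?; have -> : 1 + (size (h (U 0 0)) - 1) = size (h (U 0 0)) by lia.
by rewrite shiftw_catw.
Qed.

(** As long as the two images share their first letter, that letter is [a' 0] and a factor [L] can
    be stripped; the total length decreases. *)
Lemma split_first_letter a a' g : both_io a -> both_io a' -> nonerasing g ->
  last false (g false) != last false (g true) -> maps a a' g ->
  exists m h, [/\ nonerasing h, g =1 ext (lsig a' m false) \o h
              & head false (h false) != head false (h true)].
Proof.
move=> ha; have [n] := ubnP (size (g false) + size (g true)).
elim: n g a' => // n IH g a' hn ha' hg hl hm.
case: (boolP (head false (g false) == head false (g true))) => [/eqP hh|hne]; last first.
  exists 0, g; split=> // c; rewrite /lsig /= -[LHS]ext_id; apply: eq_ext => d.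
  by rewrite addbF.
pose b := head false (g false).
have hb c : head false (g c) = b by rewrite /b; case: c.
have eb : b = a' 0.
  apply/eqP/negPn/negP => hne.
  have [U [V [hU hV e]]] := hm.
  (* The last letters differ, so one of them is [b]; as every image starts with [b], the junction
     after this letter gives a repeated [b = ~~ a' 0]. *)
  have [c hc] : exists c, last false (g c) = b.
    case: (last false (g false) =P b) => h; [by exists false|exists true].
    by move: hl h; case: (last _ _) (last _ _) (b) => [] [] [].
  have [i hi] := dseq_letter ha hU 0 c.
  have [k [h1 h2]] := app_joint (U 0) i hg.
  move: h1 h2; rewrite hi hc hb -e => h1 h2.
  have := dseq_nodouble (n := 0) (i := k) hV; rewrite h1 h2.
  by case: (b) (a' 0) hne => [] [] //= _ /(_ erefl).
have [h hh'] : exists h : bmorph, g =1 ext (L b) \o h.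
  have hx c : exists v, g c = ext (L b) v.
    have [U [V [hU hV e]]] := hm.
    apply: parse_L; last by have := hb c; have := hg c; case: (g c).
    have [k ->] := maps_factor c ha hg hU hV e.
    by rewrite eb; apply: sorted_factor.
  by have [h hh'] := choice hx; exists h.
have hhn : nonerasing h.
  by move=> c; have := hg c; rewrite hh' /=; case: (h c).
have sz c : size (g c) = size (h c) + cnt (~~ b) (h c).
  rewrite hh' /= (size_count b (ext _ _)) (size_count b (h c)) count_LN count_L.
  by rewrite (size_count b (h c)).
have hl' c : last false (g c) = last false (h c).
  by rewrite hh' /= last_ext // /L; case: eqP.
(* Distinct last letters guarantee a letter [~~ b], hence a strict decrease of the total length. *)
have hpos : 0 < cnt (~~ b) (h false) + cnt (~~ b) (h true).
  have hcnt c : last false (h c) = ~~ b -> 0 < cnt (~~ b) (h c).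
    rewrite /cnt -has_count has_pred1 => <-.
    by have := hhn c; case: (h c) => //= d w _; apply: mem_last.
  case: (last false (h false) =P ~~ b) => [/hcnt|e1]; first by lia.
  have /hcnt : last false (h true) = ~~ b; last by lia.
  by move: hl e1; rewrite !hl'; case: (last _ _) (last _ _) (b) => [] [] [].
have [||||| m [h' [h1 h2 h3]]] := IH h (shiftw 1 a') => //.
- by have := sz false; have := sz true; lia.
- exact: both_io_shift.
- by rewrite -!hl'.
- exact: maps_stripL eb hh' hm.
exists m.+1, h'; split=> // c; rewrite hh' /= h2 /= /lsig /= -!/(lsig _ _ _).
by rewrite eb -(ext_comp (L (a' 0)) (lsig (shiftw 1 a') m false)).
Qed.

(** Desubstitutes the input word instead of the output word. *)
Lemma maps_inner a a' f k : nonerasing f -> maps a a' f ->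
  maps (shiftw k a) a' (ext f \o lsig a k false).
Proof.
elim: k a f => [|k IH] a f hf hm.
  have [U [V [hU hV e]]] := hm; exists U, V; split=> //.
  by rewrite app_comp // app_flip flip0.
have {}hm : maps (shiftw 1 a) a' (ext f \o L (a 0)).
  have [U [V [hU hV e]]] := hm.
  case: (hU 0) => e0.
    by exists (fun n => U (1 + n)), V; split=> //; rewrite app_comp // e e0.
  (* The additional first letter of [U 0] is absorbed by cutting its image off the output. *)
  have [V' hV' eV] := dseq_tail (size (f (~~ a 0))) hV.
  exists (fun n => U (1 + n)), V'; split=> //.
  by rewrite eV e e0 app_catw // ext_seq1 shiftw_catw app_comp.
have [U [V [hU hV e]]] := IH _ _ (nonerasing_comp hf (nonerasing_L (a 0))) hm.
exists U, V; split=> //.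
rewrite e; apply: eq_app => c.
by rewrite /= ext_comp.
Qed.

(** Both [s] and [t] are the longest common prefix of the same two infinite words. *)
Lemma lcp_size s t (x y x' y' : word) : s +++ x = t +++ x' -> s +++ y = t +++ y' ->
  x 0 != y 0 -> x' 0 != y' 0 -> size s = size t.
Proof.
have aux s' t' (z w z' w' : word) : size s' < size t' -> s' +++ z = t' +++ z' ->
    s' +++ w = t' +++ w' -> z 0 = w 0.
  move=> h /(congr1 (fun u => u (size s'))) e1 /(congr1 (fun u => u (size s'))) e2.
  by move: e1 e2; rewrite /catw ltnn subnn h => -> ->.
move=> e1 e2 h1 h2; case: (ltngtP (size s) (size t)) => // h.
  by rewrite (aux _ _ _ _ _ _ h e1 e2) eqxx in h1.
by rewrite (aux _ _ _ _ _ _ h (esym e1) (esym e2)) eqxx in h2.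
Qed.

(* If [f] shares neither first nor last letters, then [f] composed with a long
   product of [L]'s equals a long product of [L]'s composed with some [h];
   comparing common prefixes and lengths on both sides, the excess
   [size (f 0) + size (f 1) - 2] bounds the length of the shortest image of the
   second product unless it vanishes. *)
Lemma terminal_morphism a a' f : both_io a -> both_io a' -> nonerasing f ->
  head false (f false) != head false (f true) ->
  last false (f false) != last false (f true) -> maps a a' f ->
  size (f false) + size (f true) = 2.
Proof.
move=> ha ha' hf hh hl hm.
set S := size _ + _.
have hS : 2 <= S by have := hf false; have := hf true; rewrite /S; lia.
(* [K] makes the images of length at least [S], and [k] makes the source central word longer than
   [bisp a' K], which will force [K <= m]. *)
have [K hK] := lsig_growth S ha'.
have [k /(_ k (leqnn k)) hk] := bisp_growth (size (bisp a' K)).+1 ha.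
have [||||m [h [hh1 hg hh2]]] :=
  @split_first_letter (shiftw k a) a' (ext f \o lsig a k false) _ ha'.
- exact: both_io_shift.
- exact: nonerasing_comp.
- by rewrite /= !last_ext ?nonerasing_lsig // !last_lsig.
- exact: maps_inner.

have eqX X : ext f (bisp a k) +++ app f (app (sig a (nseq k true) false) X) =
    bisp a' m +++ app (sig a' (nseq m true) false) (app h X).
  by rewrite -app_catw // -app_lsig -app_lsig -!app_comp // (eq_app _ hg).
(* On either side the letter after the displayed prefix varies with [X], because the heads of [f]
   and those of [h] differ. *)
have hB : size (ext f (bisp a k)) = size (bisp a' m).
  apply: lcp_size (eqX (fun=> false)) (eqX (fun=> true)) _ _.
    by rewrite !(app0 _ false hf) !app_rsig0.
  by rewrite !app_rsig0 !(app0 _ false hh1) !addbF.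
have hmK : K <= m.
  rewrite leqNgt; apply/negP => /ltnW /(bisp_mono a'); rewrite -hB.
  by have := size_ext (bisp a k) hf; lia.
have e1 := size_ext_lsig f a k false.
have := hg false; have := hg true; rewrite /= => g1 g0.
rewrite g1 g0 hB in e1.
have e2 := size_lsig a' m false.
have hc0 := hK m hmK false; have hc1 := hK m hmK true.
move: e1; rewrite -size_cat -ext_cat size_ext_count.
set w := h false ++ h true; move=> e1.
have w0 : 0 < cnt false w /\ 0 < cnt true w.
  rewrite /cnt -!has_count !has_pred1 !mem_cat.
  have := hh1 false; have := hh1 true; move: hh2.
  case: (h false) => // c s; case: (h true) => // d t /=.
  by case: c d => [] [] // _ _ _; rewrite !inE ?orbT.
(* One occurrence of each letter already accounts for [size (bisp a' m) + 2]; a third would need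
   length at least [S] where only [S - 2] is left. *)
case: (ltnP 2 (cnt false w + cnt true w)) => h3.
  exfalso; move: e1 e2 hc0 hc1 w0 h3; rewrite -/S -addnA -/S.
  by move=> ? ? ? ? [? ?] ?; nia.
have [c0 c1] : cnt false w = 1 /\ cnt true w = 1 by lia.
by move: e1; rewrite c0 c1 !mul1n e2 -addnA -/S; lia.
Qed.

(** Induction on the total length of the images. A shared first or last letter lets an [L] or [R] be
    stripped; if neither is shared, [terminal_morphism] leaves only the identity or the exchange. *)
Theorem decomposition a a' f : both_io a -> both_io a' -> nonerasing f -> maps a a' f ->
  exists s p, f =1 sig a' s p.
Proof.
move=> ha; have [n] := ubnP (size (f false) + size (f true)).
elim: n f a' => // n IH f a' hn ha' hf hm.
pose b := a' 0.
have [U [V [hU hV e]]] := hm.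
have no_joint c d i : U 0 i = c -> U 0 i.+1 = d ->
    last false (f c) = ~~ b -> head false (f d) = ~~ b -> False.
  move=> <- <- h1 h2; have [k [k1 k2]] := app_joint (U 0) i hf.
  move: k1 k2; rewrite h1 h2 -e => k1 k2.
  by have := dseq_nodouble hV k1; rewrite k2 /b; case: (a' 0).
have hsort c : sorted (one_of b) (f c).
  have [k ->] := maps_factor c ha hf hU hV e; exact: sorted_factor.
have step r h : f =1 ext (LR r b) \o h -> nonerasing h -> exists s p, f =1 sig a' s p.
  move=> fh hh.
  have sz c : size (f c) = size (h c) + cnt (~~ b) (h c).
    rewrite fh /= (size_count b (ext _ _)) !count_LR count_LN count_L.
    by rewrite (size_count b (h c)).
  (* Otherwise all images are powers of [b] and [V 0] is constant. *)
  have hpos : 0 < cnt (~~ b) (h false) + cnt (~~ b) (h true).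
    rewrite lt0n; apply/negP => /eqP h0.
    have hall c i : nth b (f c) i = b.
      have : cnt (~~ b) (f c) = 0 by rewrite fh /= count_LR count_LN; case: c; lia.
      rewrite /cnt => /eqP; rewrite -leqn0 leqNgt -has_count => /hasPn hno.
      case: (ltnP i (size (f c))) => hi; last by rewrite nth_default.
      by have /= := hno _ (mem_nth b hi); case: (nth b (f c) i); case: (b).
    have [i] := dseq_letter ha' hV 0 (~~ b).
    rewrite e => hi; have : app f (U 0) i = b; last by rewrite hi; case: (b).
    elim/ltn_ind: i (U 0) {hi} => i IHi x; rewrite app_cons // /catw.
    case: ltnP => hlt; first by rewrite (set_nth_default b) // hall.
    by apply: IHi; have := hf (x 0); lia.
  have [|||| s [p hs]] := IH h (shiftw 1 a') => //.
  - by have := sz false; have := sz true; lia.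
  - exact: both_io_shift.
  - case: r fh => fh; first exact: maps_stripR (erefl b) fh hm.
    exact: maps_stripL (erefl b) fh hm.
  by exists (r :: s), p => c; rewrite fh /= hs.
have stepL : (forall c, head false (f c) = b) -> exists s p, f =1 sig a' s p.
  move=> hb.
  have hx c : exists v, f c = ext (L b) v.
    by apply: parse_L => //; have := hb c; have := hf c; case: (f c).
  have [h fh] := choice hx; apply: (step false h) => // c.
  by have := hf c; rewrite fh; case: (h c).
have stepR : (forall c, last false (f c) = b) -> exists s p, f =1 sig a' s p.
  move=> hb.
  have hx c : exists v, f c = ext (R b) v.
    by apply: parse_R => //; have := hb c; have := hf c; case: (f c).
  have [h fh] := choice hx; apply: (step true h) => // c.
  by have := hf c; rewrite fh; case: (h c).
have occ c : exists i, U 0 i = c by exact: dseq_letter.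
have nb (c : bool) : c != b -> c = ~~ b by case: c (b) => [] [].
case: (boolP (head false (f false) == head false (f true))) => hh.
  case: (boolP (head false (f false) == b)) => [/eqP h0|/nb h0].
    by apply: stepL => -[]; rewrite -?(eqP hh).
  (* All images start with [~~ b], so none may end with it. *)
  apply: stepR => c; apply/eqP/negPn/negP => /nb h.
  have [i hi] := occ c; apply: (no_joint c (U 0 i.+1) i) => //.
  by case: (U 0 i.+1); rewrite -?(eqP hh).
case: (boolP (last false (f false) == last false (f true))) => hl.
  case: (boolP (last false (f false) == b)) => [/eqP h0|/nb h0].
    by apply: stepR => -[]; rewrite -?(eqP hl).
  apply: stepL => c; apply/eqP/negPn/negP => /nb h.
  (* An occurrence of [c] that has a predecessor is needed for a junction. *)
  have [i hi] : exists i, U 0 i.+1 = c.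
    by have [[|i] // hlt hi] := dseq_letter_io 0 1 c ha hU; exists i.
  apply: (no_joint (U 0 i) c i) => //.
  by case: (U 0 i); rewrite -?(eqP hl).
have h2 := terminal_morphism ha ha' hf hh hl hm.
exists [::], (head false (f false)) => c /=.
have [s0 s1] : size (f false) = 1 /\ size (f true) = 1.
  by have := hf false; have := hf true; lia.
move: s0 s1 hh; clear.
case e0 : (f false) => [|c0 []] //; case e1 : (f true) => [|c1 []] //= _ _ hne.
by case: c; rewrite ?e0 ?e1; case: c0 c1 hne {e0 e1} => [] [].
Qed.

(** * Fixed points of Sturmian morphisms *)

(** Since [R] is [L] followed by a shift by one, each [R] in the product adds to the shift, and a
    positive shift stays positive under desubstitution. *)
Lemma dseq_sig a U s p w e : dseq a U -> U 0 = shiftw e (app (sig a s p) w) ->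
  exists e', U (size s) = shiftw e' (flip p w) /\ ((0 < e) || has id s -> 0 < e').
Proof.
elim: s a U e => [|r s IH] a U e hU.
  by rewrite /= app_flip orbF => ->; exists e.
rewrite /= app_comp //; set X := app (sig _ _ _) w => e0.
have {}e0 : U 0 = shiftw (r + e) (app (L (a 0)) X).
  by rewrite e0; case: r {e0} => //=; rewrite app_LR -shiftwD shiftw1_cons.
have [j [eU hj]] : exists j, U 1 = shiftw j X /\ (0 < r + e -> 0 < j).
  have [j [[hj hs]|[hj0 [hj hs]]]] := shiftw_app_L (a 0) X (r + e);
    exists j; split=> //.
  - by apply: (@desubst_inj (a 0) (U 0)); [exact: hU|left; rewrite e0].
  - by case: j hj {hs} => //=; lia.
  - by apply: (@desubst_inj (a 0) (U 0)); [exact: hU|right; rewrite e0].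
have [e' [he' h]] := IH _ _ j (dseq_shift 1 hU) eU.
exists e'; split=> // hr; apply: h; case: (has id s) hr => [_|]; first by rewrite orbT.
rewrite !orbF => hr; apply: hj; move: hr; case: (r) => /=; lia.
Qed.

Lemma lsig_flip a k p X : app (lsig a k p) X = app (lsig a k false) (flip p X).
Proof.
rewrite -app_flip -app_comp //; apply: eq_app => c.
by rewrite /= ext_seq1 -{1}(addn0 k) lsigD /lsig /= ext_seq1.
Qed.

Lemma dseq_lsig a U k p w : dseq a U -> U 0 = app (lsig a k p) w ->
  U k = flip p w /\ forall n, n < k -> U n = app (L (a n)) (U n.+1).
Proof.
elim: k a U => [|k IH] a U hU; first by rewrite app_flip.
rewrite /lsig /= app_comp // -/(lsig _ _ _) => e0.
have e1 : U 1 = app (lsig (shiftw 1 a) k p) w.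
  by apply: (@desubst_inj (a 0) (U 0)); [exact: hU|left].
have [h1 h2] := IH _ _ (dseq_shift 1 hU) e1.
by split=> // -[_|n hn]; [rewrite e1|apply: (h2 n)].
Qed.

Lemma catw_size_inj a U s t : both_io a -> dseq a U -> s +++ U 0 = t +++ U 0 -> size s = size t.
Proof.
move=> ha hU.
wlog hst : s t / size s <= size t.
  by move=> H; case: (leqP (size s) (size t)) => [|/ltnW] h e; [|apply/esym]; apply: H.
move=> /(congr1 (shiftw (size t))); rewrite shiftw_catw shiftw_catw_ge // => e.
have := @dseq_aperiodic a U (size t - size s) 0 ha hU; rewrite shiftw0 e => /(_ erefl).
lia.
Qed.

(** If [a 0 = d], the square desubstitutes to the same square before the next characteristic word;
    at the first directive letter [~~ d] a repeated [d] is forbidden. *)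
Lemma no_square_before_char a U V d : both_io a -> dseq a U -> charseq a V ->
  U 0 <> [:: d; d] +++ V 0.
Proof.
move=> ha; have [k [_ hk]] := ha 0 (~~ d).
elim: k a ha hk U V => [|k IH] a ha hk U V hU hV e0.
  have := dseq_nodouble (n := 0) (i := 0) hU; rewrite e0 hk /catw /= negbK => /(_ erefl).
  by case: (d).
case: (a 0 =P d) => h0; last first.
  have {}h0 : a 0 = ~~ d by move: h0; case: (a 0); case: (d).
  have := dseq_nodouble (n := 0) (i := 0) hU; rewrite e0 h0 /catw /= negbK => /(_ erefl).
  by case: (d).
apply: (IH _ (both_io_shift 1 ha) hk _ _ (dseq_shift 1 hU) (charseq_shift 1 hV)).
apply: (@desubst_inj (a 0) (U 0)); first exact: hU.
by left; rewrite app_catw // -hV e0 h0 /ext /L /= eqxx.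
Qed.

Section FixedPoint.
Variables (a : word) (U : nat -> word) (f : bmorph).
Hypotheses (ha : both_io a) (hU : dseq a U) (hf : nonerasing f) (hfix : app f (U 0) = U 0).

Lemma fixed_decomposition : exists s p, f =1 sig a s p.
Proof.
by apply: (decomposition ha ha hf); exists U, U; split.
Qed.

Variables (s : seq bool) (p : bool).
Hypothesis hs : f =1 sig a s p.

Lemma fixed_derive : exists e, U (size s) = shiftw e (flip p (U 0)) /\ (has id s -> 0 < e).
Proof.
have e0 : U 0 = shiftw 0 (app (sig a s p) (U 0)) by rewrite shiftw0 -(eq_app _ hs) hfix.
by have [e [h1 h2]] := dseq_sig hU e0; exists e.
Qed.

(** The word at level [size s] is, up to the exchange, a shift of [U 0], and shifts share their
    directive sequence. *)
Lemma fixed_directive : shiftw (size s) a = flip p a.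
Proof.
have [e [he _]] := fixed_derive.
have [W hW eW] := dseq_tail e (dseq_flip p hU).
have h := dseq_unique (both_io_shift (size s) ha) (both_io_flip p ha)
  (dseq_shift (size s) hU) hW.
have hh : U (size s + 0) = W 0 by rewrite addn0 he eW.
by apply/funext => n; have [_] := h hh n.
Qed.

(** A pure [L] product yields the first alternative at the first [size s] levels; as level [size s]
    is again [U 0] up to the exchange, this propagates to all levels. *)
Lemma fixed_L_char : 0 < size s -> ~~ has id s -> charseq a U.
Proof.
move=> hk hns.
have es : s = nseq (size s) false.
  apply/all_pred1P; rewrite -all_predC in hns.
  by apply: sub_all hns => -[].
have e0 : U 0 = app (lsig a (size s) p) (U 0).
  by rewrite -{1}hfix; apply: eq_app => c; rewrite hs {1}es.
have [h1 h2] := dseq_lsig hU e0.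
have hper := dseq_unique (both_io_shift (size s) ha) (both_io_flip p ha)
  (dseq_shift (size s) hU) (dseq_flip p hU) _.
rewrite addn0 in hper.
elim/ltn_ind => n IH; case: (ltnP n (size s)) => hn; first exact: h2.
have [u1 _] := hper h1 (n - size s); have [u2 _] := hper h1 (n - size s).+1.
move: u1 u2; rewrite addnS subnKC // => -> ->.
rewrite (IH (n - size s)); last by lia.
rewrite flip_app_L -/(flip p a (n - size s)) -fixed_directive.
by rewrite /shiftw subnKC.
Qed.

Variable V : nat -> word.
Hypothesis hV : charseq a V.

Lemma fixed_lsig_char : app (lsig a (size s) p) (V 0) = V 0.
Proof.
rewrite lsig_flip.
have <- : V (size s) = flip p (V 0); last by rewrite -charseq_lsig.
have := charseq_shift (size s) hV; rewrite fixed_directive => h1.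
have h2 : charseq (flip p a) (fun n => flip p (V n)).
  by move=> n; rewrite -flip_app_L -hV.
by have := charseq_unique (both_io_flip p ha) h1 h2; rewrite addn0.
Qed.

(** Applying the [L] product to [U 0] in two ways gives the same word, with [V 0] behind either
    prefix; aperiodicity equates the lengths. *)
Lemma fixed_prefix_size z : U 0 = z +++ V 0 ->
  size (pfx a s) + size z = size (ext (lsig a (size s) p) z).
Proof.
move=> e.
rewrite -size_cat; apply: (catw_size_inj ha (charseq_dseq hV)).
rewrite catw_cat -e -{1}hfix (eq_app _ hs) -app_lsig_sig e app_catw //.
by rewrite fixed_lsig_char.
Qed.

Hypothesis hboth : forall c, 1 < size (f c).

(** For [E > 2] the prefix [z] contains both letters. In [fixed_prefix_size], [pfx] is at most the
    two image lengths less 2, so the remaining [E - 2] letters would have images of total length at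
    most [E - 2], although each image has length at least 2. *)
Lemma fixed_char_tail E : shiftw E (U 0) = V 0 -> E <= 2.
Proof.
move=> hE; rewrite leqNgt; apply/negP => h3.
set z := mkseq (U 0) E.
have := @fixed_prefix_size z; rewrite -hE catw_shiftw => /(_ erefl).
have := size_pfx a s; have := size_lsig a (size s) p.
rewrite size_ext_count.
have hc c : 1 < size (lsig a (size s) p c) by rewrite -size_sig -hs.
have := hc false; have := hc true.
have : size z = E by rewrite size_mkseq.
rewrite (size_count false z) /=.
have [hf0 ht0] : 0 < cnt false z /\ 0 < cnt true z.
  have hn (d : bool) : 0 < cnt d z.
    rewrite /cnt -has_count has_pred1.
    have [W hW eW] := dseq_tail (E - 2) hU.
    (* The last two letters of [z] differ because no square precedes a characteristic word. *)
    have hne : U 0 (E - 2) != U 0 (E - 1).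
      apply/negP => /eqP h; apply: (no_square_before_char (d := U 0 (E - 2)) ha hW hV).
      rewrite eW -hE -{1}(catw_shiftw 2 (shiftw _ _)) shiftwD; congr (_ +++ shiftw _ _); last lia.
      by rewrite /mkseq /= /shiftw addn0; congr [:: _; _]; rewrite h; congr (U 0 _); lia.
    have hin i : i < E -> U 0 i \in z.
      by move=> hi; apply/mapP; exists i => //; rewrite mem_iota.
    have i1 := hin (E - 2); have i2 := hin (E - 1).
    by move: hne i1 i2; case: (U 0 (E - 2)); case: (U 0 (E - 1)); case: d => // _ i1 i2;
      [apply: i1|apply: i2|apply: i2|apply: i1]; lia.
  by split.
move: (size (lsig _ _ _ false)) (size (lsig _ _ _ true)) hf0 ht0 => t0 t1.
case: (cnt false z) (cnt true z) => [|m0] [|m1] // _ _ hz ht1 ht0.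
have h0 : m0 * 2 <= m0 * t0 by rewrite leq_mul2l ht0 orbT.
have h1 : m1 * 2 <= m1 * t1 by rewrite leq_mul2l ht1 orbT.
rewrite !mulSn; lia.
Qed.

End FixedPoint.

(** * Derived words *)

Definition occ (x : word) (v : seq bool) (i : nat) := exists z, shiftw i x = v +++ z.

(* [q] is the part of [x] before the first occurrence of [v], and [r c] is the
   return word coded by the letter [c]. *)
Definition der (x : word) (v : seq bool) (d : word) := exists q r,
  [/\ nonerasing r, r false <> r true, x = q +++ app r d &
      forall i, occ x v i <-> exists j, i = size q + size (ext r (mkseq d j))].

Lemma der_nil x : der x [::] x.
Proof.
exists [::], (fun c => [:: c]); split=> //; first by rewrite catw_nil app_id.
move=> i; split=> _; last by exists (shiftw i x); rewrite catw_nil.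
by exists i; rewrite ext_id size_mkseq.
Qed.

Lemma der_eq_occ x v v' d : (forall i, occ x v i <-> occ x v' i) -> der x v d -> der x v' d.
Proof.
move=> h [q [r [h1 h2 h3 h4]]]; exists q, r; split=> // i.
by rewrite -h4 h.
Qed.

(** If [f] carries occurrences to occurrences, the return words are replaced by their images while
    the word coding them stays the same. *)
Lemma der_app f w x y v v' d : nonerasing f -> injective (ext f) -> x = w +++ app f y ->
  (forall i, occ x v' i <->
     exists j, i = size w + size (ext f (mkseq y j)) /\ occ y v j) ->
  der y v d -> der x v' d.
Proof.
move=> hf hinj ex hocc [q [r [hr hne ey hv]]].
exists (w ++ ext f q), (ext f \o r); split.
- exact: nonerasing_comp.
- by move=> /= /hinj.
- by rewrite app_comp // catw_cat -app_catw // -ey.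
have e j : mkseq y (size q + size (ext r (mkseq d j))) = q ++ ext r (mkseq d j).
  by rewrite ey mkseq_catw (app_split d j hr) mkseq_catw_size.
have sz j : size (w ++ ext f q) + size (ext (ext f \o r) (mkseq d j)) =
   size w + size (ext f (mkseq y (size q + size (ext r (mkseq d j))))).
  by rewrite e ext_cat !size_cat ext_comp addnA.
move=> i; rewrite hocc; split.
  by move=> [j [-> /hv [k ->]]]; exists k; rewrite sz.
move=> [k ->]; eexists; split; first exact: sz.
by apply/hv; exists k.
Qed.

(** The trailing [b] certifies that the last block is complete: alone, [b] could also begin the
    image of [~~ b]. *)
Lemma prefix_L b v y :
  (exists z, app (L b) y = (ext (L b) v ++ [:: b]) +++ z) <-> exists z, y = v +++ z.
Proof.
split; last first.
  move=> [z ->]; exists (app (R b) z); by rewrite app_catw // app_LR catw_cat.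
elim: v y => [|c v IH] y [z e]; first by exists y; rewrite catw_nil.
have hd : exists w, ext (L b) v ++ [:: b] = b :: w.
  case: (v) => [|d w]; first by exists [::].
  by rewrite ext_cons /L; case: (d =P b) => _ /=; eexists.
have ey : y 0 = c.
  rewrite -(app_L1 b) e ext_cons -catA; have [w ->] := hd.
  by rewrite /L; case: (c =P b) => [->|] .
move: e; rewrite app_cons // ext_cons -catA catw_cat ey => e.
have [_ e'] := catw_inj erefl e.
have [z' hz] := IH _ (ex_intro _ z e').
by exists z'; rewrite -cat1s catw_cat -hz -ey catw_shiftw1.
Qed.

Lemma prefix_R b v y :
  (exists z, app (R b) y = ext (R b) v +++ z) <-> exists z, y = v +++ z.
Proof.
split; last by move=> [z ->]; exists (app (R b) z); rewrite app_catw.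
elim: v y => [|c v IH] y [z e]; first by exists y; rewrite catw_nil.
have ey : y 0 = c.
  by rewrite -(app_R0 b) e ext_cons /R; case: (c =P b) => [->|].
move: e; rewrite app_cons // ext_cons catw_cat ey => e.
have [_ e'] := catw_inj erefl e.
have [z' hz] := IH _ (ex_intro _ z e').
by exists z'; rewrite -cat1s catw_cat -hz -ey catw_shiftw1.
Qed.

Lemma occ_head x c v i : occ x (c :: v) i -> x i = c.
Proof. by move=> [z /(congr1 (fun u => u 0))]; rewrite /shiftw addn0. Qed.

Lemma occ_app_L b y v i : occ (app (L b) y) (ext (L b) v ++ [:: b]) i <->
  exists j, i = size (ext (L b) (mkseq y j)) /\ occ y v j.
Proof.
split; last first.
  move=> [j [-> /prefix_L h]]; have [z e] := h b; exists z.
  by rewrite (app_split y j) // shiftw_catw.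
move=> h; have [j [[hj hs]|[_ [_ hs]]]] := shiftw_app_L b y i.
  exists j; split=> //; apply/(prefix_L b); have [z] := h; rewrite hs => e.
  by exists z.
exfalso; have : app (L b) y i = b.
  case: (v) h => [|c w]; first by move/occ_head.
  by rewrite ext_cons {2}/L; case: (c =P b) => _ /= /occ_head.
by have := congr1 (fun u => u 0) hs; rewrite /shiftw addn0 => ->; rewrite catw_cons0; case: (b).
Qed.

Lemma shiftw_app_R b x e :
  exists j, (e = size (ext (R b) (mkseq x j)) /\ shiftw e (app (R b) x) = app (R b) (shiftw j x))
   \/ (e.+1 = size (ext (R b) (mkseq x j)) /\ app (R b) x e = b).
Proof.
have cut j : shiftw (size (ext (R b) (mkseq x j))) (app (R b) x) = app (R b) (shiftw j x).
  by rewrite (app_split x j) // shiftw_catw.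
elim: e => [|e [j [[he hs]|[he hs]]]].
- by exists 0; left; rewrite !shiftw0.
- have hS : mkseq x j.+1 = mkseq x j ++ [:: x j] by rewrite -addn1 mkseqD /mkseq /= /shiftw addn0.
  exists j.+1; case: (x j =P b) => hxj.
    left; have hz : e.+1 = size (ext (R b) (mkseq x j.+1)).
      by rewrite hS ext_cat size_cat -he ext_seq1 /R hxj eqxx addn1.
    by split=> //; rewrite hz cut.
  right; split.
    by rewrite hS ext_cat size_cat -he ext_seq1 /R; case: eqP => // _; rewrite addn2.
  rewrite -addn1 -[LHS]/(shiftw e _ 1) hs (app_cons _ (nonerasing_R b)) /shiftw addn0.
  by rewrite /R; case: eqP.
- by exists j; left; split=> //; rewrite he cut.
Qed.

(** The word must begin with [~~ b], which occurs only at block starts, whereas [b] may also end a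
    block. *)
Lemma occ_app_R b y v i : occ (app (R b) y) (ext (R b) (~~ b :: v)) i <->
  exists j, i = size (ext (R b) (mkseq y j)) /\ occ y (~~ b :: v) j.
Proof.
split; last first.
  move=> [j [-> /prefix_R h]]; have [z e] := h b; exists z.
  by rewrite (app_split y j) // shiftw_catw.
move=> h; have [j [[hj hs]|[_ hs]]] := shiftw_app_R b y i.
  exists j; split=> //; apply/(prefix_R b); have [z] := h; rewrite hs => e.
  by exists z.
exfalso; move: h; rewrite ext_cons {2}/R; case: (b) hs => /= hs /occ_head;
  by rewrite hs.
Qed.

Lemma ext_R_inj b : injective (ext (R b)).
Proof.
move=> s t e; apply: (@ext_L_inj b).
have : rcons (ext (L b) s) b = rcons (ext (L b) t) b by rewrite -!cats1 -!cons_ext_R e.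
by move/rcons_inj => [].
Qed.

Lemma occ_catw_cons c x v i : (i = 0 -> ~ occ ([:: c] +++ x) v 0) ->
  occ ([:: c] +++ x) v i <-> exists2 i', i = i'.+1 & occ x v i'.
Proof.
move=> h; split.
  case: i h => [|i] h ho; first by case: (h erefl ho).
  exists i => //; move: ho; rewrite /occ -add1n -shiftwD shiftw1_cons //.
by move=> [i' -> ho]; rewrite /occ -add1n -shiftwD shiftw1_cons.
Qed.

Lemma occ_head_neq c x d v : c != d -> ~ occ ([:: c] +++ x) (d :: v) 0.
Proof. by move=> h /occ_head e; move: h; rewrite -e eqxx. Qed.

Lemma head_ext_L b v : exists w, ext (L b) v ++ [:: b] = b :: w.
Proof.
case: v => [|d v]; first by exists [::].
by rewrite ext_cons /L; case: (d =P b) => _ /=; eexists.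
Qed.

Lemma der_L b x y v d : x = app (L b) y \/ x = [:: ~~ b] +++ app (L b) y ->
  der y v d -> der x (ext (L b) v ++ [:: b]) d.
Proof.
move=> [] ->.
  apply: (@der_app (L b) [::]) => //; first exact: ext_L_inj.
    by rewrite catw_nil.
  exact: occ_app_L.
apply: (@der_app (L b) [:: ~~ b]) => //; first exact: ext_L_inj.
move=> i; rewrite occ_catw_cons; last first.
  by move=> _; have [w ->] := head_ext_L b v; apply: occ_head_neq; case: (b).
split.
  by move=> [i' -> /occ_app_L [j [-> h]]]; exists j; split.
by move=> [j [-> h]]; eexists; first exact: erefl; apply/occ_app_L; exists j.
Qed.

Lemma der_R b x y v d : x = app (R b) y \/ x = [:: b] +++ app (R b) y ->
  der y (~~ b :: v) d -> der x (ext (R b) (~~ b :: v)) d.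
Proof.
have hd : exists w, ext (R b) (~~ b :: v) = ~~ b :: w.
  by rewrite ext_cons /R; case: (b) => /=; eexists.
move=> [] ->.
  apply: (@der_app (R b) [::]) => //; first exact: ext_R_inj.
    by rewrite catw_nil.
  exact: occ_app_R.
apply: (@der_app (R b) [:: b]) => //; first exact: ext_R_inj.
move=> i; rewrite occ_catw_cons; last first.
  by move=> _; have [w ->] := hd; apply: occ_head_neq; case: (b).
split.
  by move=> [i' -> /occ_app_R [j [-> h]]]; exists j; split.
by move=> [j [-> h]]; eexists; first exact: erefl; apply/occ_app_R; exists j.
Qed.

Lemma occ_L_back b x y v i : x = app (L b) y \/ x = [:: ~~ b] +++ app (L b) y ->
  occ x (ext (L b) v ++ [:: b]) i -> exists j, occ y v j.
Proof.
move=> [] ->; first by move/occ_app_L => [j [_ h]]; exists j.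
have [w ew] := head_ext_L b v.
rewrite occ_catw_cons; last by rewrite ew => _; apply: occ_head_neq; case: (b).
by move=> [i' _ /occ_app_L [j [_ h]]]; exists j.
Qed.

Lemma occ_R_back b x y v i : x = app (R b) y \/ x = [:: b] +++ app (R b) y ->
  occ x (ext (R b) (~~ b :: v)) i -> exists j, occ y (~~ b :: v) j.
Proof.
move=> [] ->; first by move/occ_app_R => [j [_ h]]; exists j.
rewrite occ_catw_cons; last first.
  by move=> _; rewrite ext_cons {2}/R; case: (b) => /=; apply: occ_head_neq.
by move=> [i' _ /occ_app_R [j [_ h]]]; exists j.
Qed.

(** Starting from the empty word, each level replaces [v] by its [L] image followed by the directive
    letter. *)
Lemma dseq_der a U k : dseq a U -> exists2 v, der (U 0) v (U k) & exists i, occ (U 0) v i.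
Proof.
move=> hU.
suff [v hv] : exists v, der (U 0) v (U k).
  exists v => //; have [q [r [_ _ _ h]]] := hv.
  by exists (size q); apply/h; exists 0; rewrite addn0.
elim: k a U hU => [|k IH] a U hU; first by exists [::]; apply: der_nil.
have [v hv] := IH _ _ (dseq_shift 1 hU).
by exists (ext (L (a 0)) v ++ [:: a 0]); apply: der_L hv; apply: hU.
Qed.

(* The left extensions of a characteristic word that are fixed points of
   substitutions as soon as the characteristic word is. *)
Definition stype (t : seq bool) :=
  t \in [:: [::]; [:: false]; [:: true]; [:: false; true]; [:: true; false]].

Lemma stypeP b t : stype t ->
  t = [::] \/ [\/ t = [:: b], t = [:: ~~ b], t = [:: b; ~~ b] | t = [:: ~~ b; b]].
Proof.
rewrite /stype !inE => /or4P [/eqP ->|||/orP []]; first (by left); move=> /eqP ->; right;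
  case: b; first [by constructor 1|by constructor 2|by constructor 3|by constructor 4].
Qed.

(** * Derived words of left extensions of characteristic words *)

Section Special.
Variables (a : word) (V : nat -> word).
Hypotheses (ha : both_io a) (hV : charseq a V).

Lemma stype_L t n : stype t -> exists2 t', stype t' &
  t +++ V n = app (L (a n)) (t' +++ V n.+1) \/
  t +++ V n = [:: ~~ a n] +++ app (L (a n)) (t' +++ V n.+1).
Proof.
set b := a n.
have e : V n = app (L b) (V n.+1) by exact: hV.
have Lb : L b b = [:: b] by rewrite /L eqxx.
have Lnb : L b (~~ b) = [:: b; ~~ b] by rewrite /L; case: (b).
case/(stypeP b) => [|[]] ->.
- by exists [::] => //; left; rewrite !catw_nil.
- exists [:: b]; first by case: (b).
  by left; rewrite app_catw // ext_seq1 Lb -e.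
- by exists [::] => //; right; rewrite catw_nil e.
- exists [:: ~~ b]; first by case: (b).
  by left; rewrite app_catw // ext_seq1 Lnb -e.
- exists [:: b]; first by case: (b).
  by right; rewrite app_catw // ext_seq1 Lb -e -catw_cat.
Qed.

(** The [R] image of the next characteristic word is the current one without its first letter, so
    [[::]] turns into [[:: a n]]; the five extensions are stable under this too. *)
Lemma stype_R t n : stype t -> exists2 t', stype t' &
  t +++ V n = app (R (a n)) (t' +++ V n.+1) \/
  t +++ V n = [:: a n] +++ app (R (a n)) (t' +++ V n.+1).
Proof.
set b := a n.
have e : V n = [:: b] +++ app (R b) (V n.+1) by rewrite -app_LR; exact: hV.
have Rb : R b b = [:: b] by rewrite /R eqxx.
have Rnb : R b (~~ b) = [:: ~~ b; b] by rewrite /R; case: (b).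
case/(stypeP b) => [|[]] ->.
- exists [:: b]; first by case: (b).
  by left; rewrite catw_nil app_catw // ext_seq1 Rb -e.
- exists [:: b]; first by case: (b).
  by right; rewrite app_catw // ext_seq1 Rb -e.
- exists [:: ~~ b]; first by case: (b).
  by left; rewrite app_catw // ext_seq1 Rnb e -catw_cat.
- exists [:: b; ~~ b]; first by case: (b).
  by left; rewrite app_catw // ext_cons ext_seq1 Rb Rnb e -catw_cat.
- exists [:: ~~ b; b]; first by case: (b).
  by left; rewrite app_catw // ext_cons ext_seq1 Rb Rnb e -catw_cat.
Qed.

Definition special_der (x : word) v := exists m t, stype t /\ der x v (t +++ V m).

(** If [c = a n], the next level codes its return words. Otherwise [c] is always followed by [a n],
    [R] transports its occurrences to the next level, and this is repeated until the directive
    letter is [c]. *)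
Lemma special_der_letter t n c : stype t -> special_der (t +++ V n) [:: c].
Proof.
have [m [hm hc]] := ha n c.
have [k hk] : exists k, k = m - n by exists (m - n).
elim: k n t hm hk => [|k IH] n t hm hk ht; case: (a n =P c) => hac.
- have [t' ht' h] := stype_L n ht.
  exists n.+1, t'; split=> //; rewrite -hac.
  exact: (der_L h (der_nil _)).
- by case: hac; rewrite -hc; congr a; lia.
- have [t' ht' h] := stype_L n ht.
  exists n.+1, t'; split=> //; rewrite -hac.
  exact: (der_L h (der_nil _)).
have [t' ht' h] := stype_R n ht.
have hcb : c = ~~ a n by case: (a n) (c) hac => [] [].
have [|| m' [t'' [ht'' hd]]] := IH n.+1 t' _ _ ht'; try lia.
exists m', t''; split=> //.
rewrite hcb in hd; have := der_R h hd; apply: der_eq_occ => i.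
have nod j : (t +++ V n) j = ~~ a n -> (t +++ V n) j.+1 = a n.
  have [t1 _ [] ->] := stype_L n ht; first exact: app_L_nodouble.
  case: j => [|j]; first by rewrite /catw /= app_L0.
  by rewrite /catw /= !subn1 /=; apply: app_L_nodouble.
rewrite hcb ext_seq1 /R; case: eqP => [|_]; first by case: (a n).
split=> -[z hz].
  by exists ([:: a n] +++ z); rewrite hz -catw_cat.
exists (shiftw i.+2 (t +++ V n)).
have h0 := occ_head (ex_intro _ z hz).
rewrite -{1}(catw_shiftw 2 (shiftw i _)) shiftwD addn2; congr (_ +++ _).
by rewrite /mkseq /= /shiftw addn0 h0 addn1 nod.
Qed.

(** Induction on the length of [v], desubstituting by [L] or [R] according to whether [v] starts
    with the directive letter or with the other one. *)
Lemma special_der_all t n v : stype t -> (exists i, occ (t +++ V n) v i) ->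
  special_der (t +++ V n) v.
Proof.
have [k] := ubnP (size v); elim: k v t n => // k IH v t n hk ht [i0 hi0].
case: v hk hi0 => [|c [|c' v']] hk hi0.
- by exists n, t; split=> //; apply: der_nil.
- exact: special_der_letter.
move: hk hi0; set v := c :: c' :: v' => hk hi0.
set x := t +++ V n; pose b := a n.
have nod j : x j = ~~ b -> x j.+1 = b.
  rewrite /x; have [t1 _ [] ->] := stype_L n ht; first exact: app_L_nodouble.
  case: j => [|j]; first by rewrite /catw /= app_L0.
  by rewrite /catw /= !subn1 /=; apply: app_L_nodouble.
have occ_nth i j : occ x v i -> j < size v -> x (i + j) = nth false v j.
  move=> [z hz] hj; rewrite -[LHS]/(shiftw i x j) hz /catw hj //.
have srt : sorted (one_of b) v.
  apply/(sortedP false) => j hj; rewrite /one_of.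
  rewrite -!(occ_nth i0) //; last by lia.
  rewrite addnS; case: (x (i0 + j) =P b) => //= hne.
  by apply/eqP/nod; move: hne; case: (x _); case: (b).
(* A final [~~ b] is always followed by [b], so appending [b] keeps the occurrences; both parsings
   require the final [b]. *)
pose v1 := if last false v == b then v else rcons v b.
have occ1 i : occ x v1 i <-> occ x v i.
  rewrite /v1; case: (last false v =P b) => // hl; split=> -[z hz].
    by exists ([:: b] +++ z); rewrite hz -catw_cat cats1.
  exists (shiftw (size v).+1 (shiftw i x)).
  rewrite -{1}(catw_shiftw (size v).+1 (shiftw i x)); congr (_ +++ _).
  rewrite -addn1 mkseqD hz mkseq_catw_size -cats1 -hz; congr (_ ++ _).
  rewrite /mkseq /=; congr [:: _]; rewrite /shiftw addn0.
  have -> : i + size v = (i + (size v).-1).+1 by rewrite /= addnS.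
  apply: nod; rewrite occ_nth //; last by exists z.
  by rewrite nth_last; move: hl; rewrite /=; case: (last _ _); case: (b).
have lst1 : last b v1 = b.
  by rewrite /v1; case: (last false v =P b) => //; rewrite last_rcons.
have srt1 : sorted (one_of b) v1.
  rewrite /v1; case: (last false v =P b) => // _.
  rewrite -[sorted _ _]/(path (one_of b) c (rcons (c' :: v') b)) rcons_path.
  by rewrite -[path _ _ _]/(sorted (one_of b) v) srt /one_of eqxx orbT.
(* The appended letter must be outweighed for the induction: parsing saves one letter per [~~ b],
   and in the [L] case also the final [b]. *)
have hcnt : size v1 = size v \/
    size v1 = (size v).+1 /\ (c == ~~ b) + 1 <= cnt (~~ b) v1.
  rewrite /v1; case: (last false v =P b) => hl; [by left|right].
  rewrite size_rcons; split=> //; rewrite -cats1 cnt_cat /v cnt_cons -addnA leq_add2l.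
  suff : 0 < cnt (~~ b) (c' :: v') by lia.
  rewrite /cnt -has_count has_pred1.
  have -> : ~~ b = last c' v' by move: hl; rewrite /v /=; case: (last _ _); case: (b).
  exact: mem_last.
suff [m [t' [ht' hd]]] : special_der x v1.
  by exists m, t'; split=> //; apply: der_eq_occ hd.
have hocc : occ x v1 i0 by apply/occ1.
case: (c =P b) => hc.
  (* [v1] starts and ends with [b], so all but its last letter is parsed by [L] *)
  have [w ew] : exists w, v1 = ext (L b) w ++ [:: b].
    have [u eu] : exists u, v1 = rcons u b.
      have : 0 < size v1 by move: hcnt; rewrite /v /=; lia.
      by move: lst1; case/lastP: (v1) => // u d; rewrite last_rcons => -> _; exists u.
    have hu : head b u = b.
      have : head b v1 = b by rewrite /v1; case: ifP => _; rewrite /v /= hc.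
      by rewrite eu; case: (u).
    have su : sorted (one_of b) u.
      by move: srt1; rewrite eu; case: (u) => //= d s; rewrite rcons_path => /andP [].
    by have [w hw] := parse_L su hu; exists w; rewrite -hw cats1.
  have [t' ht' h] := stype_L n ht.
  have szw : size w < k.
    have : size v1 = size w + cnt (~~ b) w + 1.
      rewrite ew size_cat /= (size_count b (ext _ _)) count_L count_LN; lia.
    have : cnt (~~ b) v1 = cnt (~~ b) w.
      by rewrite ew cnt_cat count_LN cnt_cons; case: (b); rewrite /cnt /= ?addn0.
    move: hcnt hk; rewrite /v /=; lia.
  have [|m [t'' [ht'' hd]]] := IH w t' n.+1 szw ht'.
    by rewrite ew in hocc; apply: occ_L_back h hocc.
  by exists m, t''; split=> //; rewrite ew; apply: der_L h hd.
have {}hc : c = ~~ b by move: hc; case: (c); case: (b).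
have [w ew] := parse_R srt1 lst1.
have [w' ew'] : exists w', w = ~~ b :: w'.
  have : head b v1 = ~~ b by rewrite /v1; case: ifP => _; rewrite /v /= hc.
  rewrite ew; case: (w) => [|d u] /=; first by case: (b).
  by rewrite ext_cons /R; case: (d =P b) => /= [_|_ <-]; [case: (b)|exists u].
have [t' ht' h] := stype_R n ht.
have szw : size w < k.
  have : size v1 = size w + cnt (~~ b) w.
    by rewrite ew (size_count b (ext _ _)) !(@count_LR true) count_L count_LN.
  have : cnt (~~ b) v1 = cnt (~~ b) w.
    by rewrite ew (@count_LR true) count_LN.
  have : 0 < cnt (~~ b) w by rewrite ew' cnt_cons eqxx.
  move: hcnt hk; rewrite /v /= hc eqxx; lia.
have [|m [t'' [ht'' hd]]] := IH w t' n.+1 szw ht'.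
  by rewrite ew ew' in hocc; rewrite ew'; apply: occ_R_back h hocc.
by exists m, t''; split=> //; rewrite ew ew'; apply: der_R h _; rewrite -ew'.
Qed.

End Special.

(** * Words over the alphabet of natural numbers *)

Definition natw (x : word) : nat -> nat := fun n => nat_of_bool (x n).
Definition nats (w : seq bool) : seq nat := map nat_of_bool w.
Definition mof (f : bmorph) : morph := [:: nats (f false); nats (f true)].
Definition represents (psi : morph) (f : bmorph) := forall c : bool, img psi c = nats (f c).

Lemma nats_inj : injective nats.
Proof. by apply: inj_map => -[] []. Qed.

Lemma natw_surj (u : nat -> nat) : (forall i, u i < 2) -> u = natw (fun i => u i == 1).
Proof. by move=> h; apply/funext => i; rewrite /natw; case: (u i) (h i) => [|[]]. Qed.

Lemma mof_represents f : represents (mof f) f.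
Proof. by case. Qed.

Lemma mkseq_natw x n : mkseq (natw x) n = nats (mkseq x n).
Proof. by rewrite /nats /mkseq -map_comp. Qed.

Lemma nth_nats w i : i < size w -> nth 0 (nats w) i = nat_of_bool (nth false w i).
Proof. by move=> h; rewrite (nth_map false). Qed.

Lemma mapply_represents psi f w : represents psi f -> mapply psi (nats w) = nats (ext f w).
Proof.
move=> h; elim: w => //= c w IH.
rewrite -[LHS]/(img psi c ++ mapply psi (nats w)) IH h ext_cons /nats map_cat //.
Qed.

Lemma mpow_represents psi f n w : represents psi f ->
  mpow psi n (nats w) = nats (iter n (ext f) w).
Proof.
by move=> h; elim: n => //= n IH; rewrite -(mapply_represents _ h) -IH.
Qed.

Lemma mem_nats (c : bool) w : (nat_of_bool c \in nats w) = (c \in w).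
Proof. by apply: mem_map => -[] []. Qed.

Lemma fixed_app psi f x : represents psi f -> nonerasing f -> fixed_by psi (natw x) ->
  app f x = x.
Proof.
move=> hr hf [_ [h _]]; apply/funext => n.
have := h n.+1 n; rewrite /Defs.prefix mkseq_natw (mapply_represents _ hr).
have hn : n < size (ext f (mkseq x n.+1)).
  by have := size_ext (mkseq x n.+1) hf; rewrite size_mkseq.
rewrite size_map => /(_ hn); rewrite nth_nats // /natw /app.
by case: (nth _ _ _); case: (x n).
Qed.

Lemma app_fixed f x : nonerasing f -> app f x = x -> fixed_by (mof f) (natw x).
Proof.
move=> hf e; split; first by move=> i; rewrite /natw; case: (x i).
have hm n : mapply (mof f) (Defs.prefix (natw x) n) = nats (ext f (mkseq x n)).
  by rewrite /Defs.prefix mkseq_natw; apply: mapply_represents (@mof_represents f).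
split.
  move=> n i; rewrite hm size_map => hi.
  by rewrite nth_nats // /natw -{2}e (app_split x n) // /catw hi.
move=> N; exists N; rewrite hm size_map.
by have := size_ext (mkseq x N) hf; rewrite size_mkseq.
Qed.

Lemma app_iter f n x : nonerasing f ->
  app (fun c => iter n (ext f) [:: c]) x = iter n (app f) x /\
  nonerasing (fun c => iter n (ext f) [:: c]).
Proof.
move=> hf; elim: n => [|n [IH1 IH2]]; first by rewrite app_id.
split; last by move=> c; apply: (leq_trans _ (size_ext _ hf)); apply: IH2.
by rewrite iterS -IH1 -app_comp //; apply: eq_app.
Qed.

(** Passing to a power makes both letters occur in both images and preserves fixed points. *)
Lemma primitive_power psi : primitive psi -> alph psi = 2 ->
  exists f : bmorph, [/\ nonerasing f, forall c d, d \in f c &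
    forall y, fixed_by psi (natw y) -> app f y = y].
Proof.
move=> [hwf [n [hn hprim]]] h2.
pose f : bmorph := fun c => [seq k == 1 | k <- img psi c].
have hr : represents psi f.
  move=> c; rewrite /f /nats -map_comp -[LHS]map_id; apply/eq_in_map => k hk /=.
  have : k < 2 by rewrite -h2; apply: hwf hk; rewrite h2; case: (c).
  by case: k {hk} => [|[]].
have hmem (c d : bool) : d \in iter n (ext f) [:: c].
  rewrite -mem_nats -(mpow_represents n [:: c] hr).
  by apply: hprim; rewrite h2; [case: (c)|case: (d)].
have hf : nonerasing f.
  (* An empty image would remain empty in the power. *)
  move=> c; rewrite lt0n; apply/negP => /nilP h0.
  have := hmem c c; case: n hn {hprim hmem} => // m _.
  rewrite iterSr ext_seq1 h0.
  by have -> : iter m (ext f) [::] = [::] by elim: m => //= m ->.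
have [h1 h1'] := app_iter n (fun=> false) hf.
exists (fun c => iter n (ext f) [:: c]); split=> // y hy.
have [-> _] := app_iter n y hf.
have e := fixed_app hr hf hy.
by elim: (n) => //= m ->.
Qed.

Lemma fixed_prefix psi u k n : fixed_by psi u ->
  exists m, mpow psi n (mkseq u k) = mkseq u m.
Proof.
move=> [_ [h _]]; elim: n => [|n [m IH]]; first by exists k.
rewrite /mpow iterS -/(mpow _ _ _) IH.
exists (size (mapply psi (mkseq u m))); apply: (@eq_from_nth _ 0).
  by rewrite size_mkseq.
by move=> i hi; rewrite nth_mkseq // h.
Qed.

(** A power of [psi] maps the first letter to a prefix of [x], which must contain every letter of
    the alphabet; a third one would not occur in the binary word [x]. *)
Lemma fixed_alph psi x : primitive psi -> fixed_by psi (natw x) ->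
  (exists i, x i = true) -> alph psi = 2.
Proof.
move=> [hwf [n [hn hprim]]] hfix [i hi].
have h1 : 1 < alph psi by have := hfix.1 i; rewrite /natw hi.
apply/eqP; rewrite eqn_leq h1 andbT leqNgt; apply/negP => h2.
have [m hm] := fixed_prefix 1 n hfix.
have := hprim (natw x 0) 2 (hfix.1 0) h2.
rewrite -[[:: natw x 0]]/(mkseq (natw x) 1) hm => /mapP [j _].
by rewrite /natw; case: (x j).
Qed.

(** Images of length at least 2 make the image of the first [n] letters determine the next one, so
    the first letter determines the fixed point. *)
Lemma fixed_point_unique (f : bmorph) x y : (forall c, 1 < size (f c)) ->
  app f x = x -> app f y = y -> x 0 = y 0 -> x = y.
Proof.
move=> h2 ex ey e0.
have hf : nonerasing f by move=> c; apply: ltnW.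
have val z n : app f z = z -> 0 < n -> z n = nth false (ext f (mkseq z n)) n.
  move=> ez hn; rewrite -{1}ez (app_split z n) // /catw ifT //.
  rewrite size_ext_count; have := size_count false (mkseq z n); rewrite size_mkseq /=.
  by have := h2 false; have := h2 true; nia.
apply/funext => n; elim/ltn_ind: n => -[|n] IH //.
rewrite (val x) // (val y) //; congr (nth _ (ext f _) _).
apply: (@eq_from_nth _ false); first by rewrite !size_mkseq.
by move=> i; rewrite size_mkseq => hi; rewrite !nth_mkseq // IH.
Qed.

Lemma primitive_substitution_mof (f : bmorph) x : (forall c d, d \in f c) ->
  app f x = x -> primitive_substitution (mof f).
Proof.
move=> hmem e.
have h2 c : 1 < size (f c) by apply: size_ge2; apply: hmem.
have hf : nonerasing f by move=> c; apply: ltnW.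
have hwf : morph_wf (mof f).
  move=> [|[|//]] b _; rewrite /img /= => /mapP [c _ ->]; by case: (c).
have bool_of a : a < 2 -> exists c : bool, a = nat_of_bool c.
  by case: a => [|[|]] // _; [exists false|exists true].
split; split=> //.
  exists 1; split=> // a b /bool_of [c ->] /bool_of [d ->].
  have := mpow_represents 1 [:: c] (@mof_represents f).
  rewrite /= ext_seq1 => ->; by rewrite mem_nats.
exists (natw x 0); split; first by rewrite /natw; case: (x 0).
split.
  have : f (x 0) = x 0 :: behead (f (x 0)).
    rewrite -[X in X :: _](congr1 (fun z => z 0) e) (app_cons x hf).
    by have := hf (x 0); case: (f (x 0)).
  move=> hx; exists (nats (behead (f (x 0)))); split.
    by rewrite -size_eq0 size_map size_behead; have := h2 (x 0); case: (size _) => [|[]].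
  by rewrite mof_represents {1}hx.
move=> N; exists N; rewrite -[[:: _]]/(nats [:: x 0]).
rewrite (mpow_represents _ _ (@mof_represents f)) size_map.
elim: N => // N IH; rewrite iterS.
set w := iter N _ _ in IH *.
have w0 : 0 < size w.
  by have [_ h] := app_iter N x hf; apply: h.
have : 2 * size w <= size (ext f w); last by lia.
rewrite size_ext_count (size_count false w) /=.
by have := h2 false; have := h2 true; nia.
Qed.

Lemma occurs_atE x v i : occurs_at (natw x) (nats v) i <-> occ x v i.
Proof.
split.
  move=> h; exists (shiftw (size v) (shiftw i x)).
  rewrite -{1}(catw_shiftw (size v) (shiftw i x)); congr (_ +++ _).
  apply: (@eq_from_nth _ false); first by rewrite size_mkseq.
  move=> j; rewrite size_mkseq => hj; rewrite nth_mkseq //.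
  have := h j; rewrite size_map => /(_ hj); rewrite nth_nats // /natw /shiftw.
  by case: (x _); case: (nth _ _ _).
move=> [z hz] j; rewrite size_map => hj; rewrite nth_nats // /natw.
by rewrite -[x _]/(shiftw i x j) hz /catw hj.
Qed.

Lemma factor_nats x v : factor (natw x) v -> exists2 v', v = nats v' & exists i, occ x v' i.
Proof.
move=> [i hi]; exists (mkseq (shiftw i x) (size v)).
  apply: (@eq_from_nth _ 0); first by rewrite size_map size_mkseq.
  by move=> j hj; rewrite nth_nats ?size_mkseq // nth_mkseq // -hi.
by exists i, (shiftw (size v) (shiftw i x)); rewrite catw_shiftw.
Qed.

Lemma slice_natw x i j : slice (natw x) i j = nats (mkseq (shiftw i x) (j - i)).
Proof.
rewrite /slice /nats /mkseq -{1}[i]addn0 iotaDl -!map_comp; exact: eq_map.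
Qed.

Section DerivedWord.
Variables (x : word) (v : seq bool) (d : word) (q : seq bool) (r : bmorph).
Hypotheses (hr : nonerasing r) (hne : r false <> r true) (ex : x = q +++ app r d).
Hypothesis hocc : forall i, occ x v i <-> exists j, i = size q + size (ext r (mkseq d j)).

Let pos j := size q + size (ext r (mkseq d j)).

Lemma pos_step j : pos j.+1 = pos j + size (r (d j)).
Proof.
rewrite /pos -addn1 mkseqD ext_cat size_cat -addnA; congr (_ + (_ + _)).
by rewrite /mkseq /= ext_seq1 /shiftw addn0.
Qed.

Lemma slice_pos j : slice (natw x) (pos j) (pos j.+1) = nats (r (d j)).
Proof.
rewrite slice_natw pos_step addKn /pos ex shiftw_catw_ge ?leq_addr // addKn.
rewrite (app_split d j) // shiftw_catw (app_cons _ hr) /shiftw addn0.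
by rewrite mkseq_catw_size.
Qed.

Lemma slice_pos_eq j j' : d j = d j' <->
  slice (natw x) (pos j) (pos j.+1) = slice (natw x) (pos j') (pos j'.+1).
Proof.
rewrite !slice_pos; split=> [->//|/nats_inj].
by case: (d j); case: (d j') => // e; case: hne; rewrite e.
Qed.

End DerivedWord.

Lemma der_derived_word x v d : der x v d -> (forall c, exists j, d j = c) ->
  derived_word (natw x) (nats v) (natw d).
Proof.
move=> [q [r [hr hne ex hocc]]] hd.
exists (fun j => size q + size (ext r (mkseq d j))); split.
  by move=> j; rewrite (pos_step d q r j); have := hr (d j); lia.
split.
  by move=> i; rewrite occurs_atE hocc; split=> -[j /esym e]; exists j.
split.
  move=> j j'; rewrite -(slice_pos_eq hr hne ex) /natw.
  by case: (d j); case: (d j').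
move=> a; split.
  move=> [j <-] b; rewrite /natw.
  case: b => [_|b hb]; first by have [i hi] := hd false; exists i; rewrite hi.
  exists j; move: hb; case: (d j) => //=; lia.
by move=> h; apply: h.
Qed.

Lemma increasing_enum_unique (f g : nat -> nat) :
  (forall j, f j < f j.+1) -> (forall j, g j < g j.+1) ->
  (forall i, (exists j, f j = i) <-> (exists j, g j = i)) -> f =1 g.
Proof.
have mono (h : nat -> nat) : (forall j, h j < h j.+1) -> forall i j, i < j -> h i < h j.
  move=> hh i j; elim: j => // j IH; rewrite ltnS leq_eqVlt => /orP [/eqP ->//|/IH H].
  exact: ltn_trans H (hh j).
have aux (h k : nat -> nat) n : (forall j, h j < h j.+1) -> (forall j, k j < k j.+1) ->
    (forall i, (exists j, h j = i) -> exists j, k j = i) ->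
    (forall m, m < n -> h m = k m) -> k n <= h n.
  move=> hh hk he IH; have [j hj] := he (h n) (ex_intro _ n erefl).
  case: (ltnP j n) => hjn; last first.
    by rewrite -hj; case: (ltngtP n j) hjn => [/(mono k hk)/ltnW||->].
  by have := mono h hh j n hjn; rewrite (IH j hjn) hj ltnn.
move=> hf hg he; elim/ltn_ind => n IH; apply/eqP; rewrite eqn_leq; apply/andP; split.
  by apply: aux => // [i|m hm]; [move/he|rewrite IH].
by apply: aux => // i; move/he.
Qed.

(** The positions are forced, and an injective coding of two return words by an initial segment of
    the naturals is fixed up to the exchange of 0 and 1. *)
Lemma derived_word_unique x v d d' : der x v d -> (forall c, exists j, d j = c) ->
  derived_word (natw x) (nats v) d' -> exists p, d' = natw (flip p d).
Proof.
move=> [q [r [hr hne ex hocc]]] hd [pos [hinc [hpos [hs hl]]]].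
have epos : pos =1 (fun j => size q + size (ext r (mkseq d j))).
  apply: increasing_enum_unique => //.
    by move=> j; rewrite (pos_step d q r j); have := hr (d j); lia.
  by move=> i; rewrite -hpos occurs_atE hocc; split=> -[j /esym e]; exists j.
have heq j j' : d' j = d' j' <-> d j = d j'.
  by rewrite hs !epos -(slice_pos_eq hr hne ex).
have [j0 e0] := hd false; have [j1 e1] := hd true.
have val j : d' j = if d j then d' j1 else d' j0.
  by case e : (d j); apply/heq; rewrite e ?e1 ?e0.
have hne01 : d' j0 <> d' j1 by move/heq; rewrite e0 e1.
have down b j : b <= d' j -> b = d' j0 \/ b = d' j1.
  move=> hb; have [/(_ (ex_intro _ j erefl))/(_ b hb) [i <-] _] := hl (d' j).
  by rewrite val; case: (d i); [right|left].
have h01 : (d' j0 = 0 /\ d' j1 = 1) \/ (d' j0 = 1 /\ d' j1 = 0).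
  have z0 := down 0 j0 (leq0n _).
  case: z0 => z; [left|right]; split=> //.
    have := down 1 j1; lia.
  have := down 1 j0; lia.
case: h01 => -[v0 v1]; [exists false|exists true]; apply/funext => j;
  by rewrite val /natw /flip v0 v1; case: (d j).
Qed.

(** * Closed sets of substitutions *)

Lemma charseq_flip p a U : charseq a U -> charseq (flip p a) (fun n => flip p (U n)).
Proof. by move=> h n; rewrite -flip_app_L -h. Qed.

(** * From a closed set to a characteristic shift *)

Section ClosedOnlyIf.
Variables (M : seq morph) (a : word) (U : nat -> word).
Hypotheses (hM : closed_under_derivation M) (ha : both_io a) (hU : dseq a U).

Let x := U 0.

(** The exchange is allowed because both the decomposition of a fixing morphism and the coding of
    return words may introduce it. *)
Let reach E := exists p psi, psi \in M /\ fixed_by psi (natw (flip p (shiftw E x))).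

Lemma flip_tail_dseq p E : exists2 Y, dseq (flip p a) Y & Y 0 = flip p (shiftw E x).
Proof.
have [W hW eW] := dseq_tail E hU.
by exists (fun n => flip p (W n)); [exact: dseq_flip|rewrite eW].
Qed.

Lemma flip_tail_letter p E c : exists i, flip p (shiftw E x) i = c.
Proof.
have [Y hY <-] := flip_tail_dseq p E.
exact: (dseq_letter (both_io_flip p ha) hY).
Qed.

(** Fixed points with the same first letter coincide and distinct shifts of [x] differ, so at most
    one [E] qualifies. *)
Lemma fixed_tail_bounded psi p c : psi \in M -> exists N, forall E,
  fixed_by psi (natw (flip p (shiftw E x))) -> flip p (shiftw E x) 0 = c -> E <= N.
Proof.
move=> hpsi.
case: (EM (exists E, fixed_by psi (natw (flip p (shiftw E x))) /\
                     flip p (shiftw E x) 0 = c)) => [[E0 [h0 c0]]|hno]; last first.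
  by exists 0 => E h1 h2; case: hno; exists E.
exists E0 => E h1 c1; apply: eq_leq.
have hprim : primitive psi by have [/(_ psi hpsi) []] := hM.
have h2 := fixed_alph hprim h0 (flip_tail_letter p E0 true).
have [f [hf hmem hfix]] := primitive_power hprim h2.
have e : flip p (shiftw E x) = flip p (shiftw E0 x).
  apply: (@fixed_point_unique f) => //; try exact: hfix.
    by move=> d; apply: size_ge2.
  by rewrite c1 c0.
apply: (dseq_aperiodic ha hU).
by rewrite -(flipK p (shiftw E _)) -/x e flipK.
Qed.

Lemma reach_bounded : exists N, forall E, reach E -> E <= N.
Proof.
have hB psi p : psi \in M -> exists N, forall E,
    fixed_by psi (natw (flip p (shiftw E x))) -> E <= N.
  move=> hpsi.
  have [N0 h0] := fixed_tail_bounded p false hpsi.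
  have [N1 h1] := fixed_tail_bounded p true hpsi.
  exists (N0 + N1) => E hE; case e : (flip p (shiftw E x) 0).
    by apply: leq_trans (h1 E hE e) (leq_addl _ _).
  by apply: leq_trans (h0 E hE e) (leq_addr _ _).
suff [N hN] : exists N, forall psi p E, psi \in M ->
    fixed_by psi (natw (flip p (shiftw E x))) -> E <= N.
  by exists N => E [p [psi [h1 h2]]]; apply: hN h2.
have : {subset M <= M} by [].
elim: {1 3}M => [|psi l IH] hl; first by exists 0.
have [|N hN] := IH; first by move=> phi h; apply: hl; rewrite inE h orbT.
have hpsi : psi \in M by apply: hl; rewrite inE eqxx.
have [N0 h0] := hB psi false hpsi; have [N1 h1] := hB psi true hpsi.
exists (N + N0 + N1) => phi p E; rewrite inE => /orP [/eqP ->|h] hE.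
  by case: p hE => [/h1|/h0]; lia.
by have := hN phi p E h hE; lia.
Qed.

(** A factor [R] in the decomposition makes the derived word at level [size s] a proper shift, again
    fixed by a member of [M]; without any [R] the word is characteristic. *)
Lemma reach_step E : reach E -> (exists2 V, charseq a V & V 0 = shiftw E x) \/
  exists2 E', E < E' & reach E'.
Proof.
move=> [p [psi [hpsi hfixed]]].
have [Y hY eY] := flip_tail_dseq p E.
rewrite -eY in hfixed.
have hpa := both_io_flip p ha.
have hprim : primitive psi by have [/(_ psi hpsi) []] := hM.
have h2 := fixed_alph hprim hfixed (dseq_letter hpa hY 0 true).
have [f [hf hmem hfix]] := primitive_power hprim h2.
have {}hfix := hfix _ hfixed.
have [s [p' hs]] := fixed_decomposition hpa hY hf hfix.
case: (boolP (has id s)) => hR; [right|left]; last first.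
  have hsz : 0 < size s.
    rewrite lt0n; apply/negP => /nilP e.
    have : 1 < size (f false) by apply: size_ge2.
    by rewrite hs e.
  have hc := fixed_L_char hpa hY hfix hs hsz hR.
  exists (fun n => flip p (Y n)); last by rewrite eY flipK.
  by rewrite -(flipK p a); apply: charseq_flip.
have [e [he /(_ hR) e0]] := fixed_derive hY hfix hs.
have [v hv hocc] := dseq_der (size s) hY.
have [|d [psi' [hd [hpsi' hfix']]]] := hM.2 psi _ (nats v) hpsi hfixed.
  by have [i hi] := hocc; exists i; apply/occurs_atE.
have [p'' ed] := derived_word_unique hv (dseq_letter hpa hY (size s)) hd.
exists (E + e); first lia.
exists (p'' (+) (p' (+) p)), psi'; split=> //; move: hfix'; rewrite ed he eY.
by rewrite -shiftwD -!flip_flip.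
Qed.

Lemma closed_char_tail : reach 0 -> exists E V, charseq a V /\ shiftw E x = V 0.
Proof.
have [N hN] := reach_bounded.
suff H k E : N - E < k -> reach E -> exists E' V, charseq a V /\ shiftw E' x = V 0.
  by apply: (H N.+1); rewrite subn0.
elim: k E => // k IH E hk hE.
have [[V hV e]|[E' h1 h2]] := reach_step hE; first by exists E, V; split.
by have := hN _ h2 => ?; apply: IH h2; lia.
Qed.

End ClosedOnlyIf.

Lemma closed_special M a U phi : closed_under_derivation M -> both_io a -> dseq a U ->
  phi \in M -> fixed_by phi (natw (U 0)) ->
  exists E V, [/\ charseq a V, shiftw E (U 0) = V 0 & E <= 2].
Proof.
move=> hM ha hU hphi hfixed.
have [|E [V [hV hE]]] := closed_char_tail hM ha hU.
  by exists false, phi; rewrite shiftw0 flip0.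
exists E, V; split=> //.
have hprim : primitive phi by have [/(_ phi hphi) []] := hM.
have h2 := fixed_alph hprim hfixed (dseq_letter ha hU 0 true).
have [f [hf hmem hfix]] := primitive_power hprim h2.
have {}hfix := hfix _ hfixed.
have [s [p hs]] := fixed_decomposition ha hU hf hfix.
by apply: (fixed_char_tail ha hU hfix hs hV) hE => c; apply: size_ge2.
Qed.

(** * A finite closed set from a periodic directive sequence *)

Section ClosedIf.
Variables (a : word) (V U : nat -> word) (t0 : seq bool) (phi : morph).
Hypotheses (ha : both_io a) (hV : charseq a V) (hU : dseq a U).
Hypotheses (ht0 : stype t0) (eU : U 0 = t0 +++ V 0).
Hypotheses (hphi : primitive_substitution phi) (hfixed : fixed_by phi (natw (U 0))).

(* The left extension [t] of the characteristic words is carried along by [R]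
   rather than by [L] exactly at these letters. *)
Definition rflag (t : seq bool) (b : bool) : bool :=
  match t with [::] => false | [:: c] => b != c | _ => true end.

Lemma special_step t n : stype t ->
  t +++ V n = app (LR (rflag t (a n)) (a n)) (t +++ V n.+1).
Proof.
set b := a n.
have e : V n = app (L b) (V n.+1) by exact: hV.
have eR : V n = [:: b] +++ app (R b) (V n.+1) by rewrite -app_LR.
have Lb : L b b = [:: b] by rewrite /L eqxx.
have Rb : R b b = [:: b] by rewrite /R eqxx.
have Rnb : R b (~~ b) = [:: ~~ b; b] by rewrite /R; case: (b).
case/(stypeP b) => [|[]] -> /=.
- by rewrite !catw_nil.
- by rewrite eqxx /= app_catw // ext_seq1 Lb -e.
- have -> : (b != ~~ b) by case: (b).
  by rewrite /= app_catw // ext_seq1 Rnb eR -catw_cat.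
- by rewrite app_catw // ext_cons ext_seq1 Rb Rnb eR -catw_cat.
- by rewrite app_catw // ext_cons ext_seq1 Rb Rnb eR -catw_cat.
Qed.

Definition special_sig t n N := sig (shiftw n a) [seq rflag t (a i) | i <- iota n N] false.

Lemma special_sig_app t n N : stype t ->
  t +++ V n = app (special_sig t n N) (t +++ V (n + N)).
Proof.
move=> ht; elim: N n => [|N IH] n; first by rewrite /special_sig /= app_flip flip0 addn0.
rewrite (special_step n ht) (IH n.+1) addSnnS -app_comp; last 2 first.
- exact: nonerasing_LR.
- exact: nonerasing_sig.
by rewrite /special_sig /= shiftwD /shiftw addn0 addn1.
Qed.

(** The default [~~ c] makes the equations on heads exclude empty words. *)
Lemma head_LR (r b c : bool) w : r = (b != c) -> head (~~ c) w = c ->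
  head (~~ c) (ext (LR r b) w) = c.
Proof.
case: w => [|d w] /= hr; first by case: (c).
by move=> ->; rewrite ext_cons hr; case: (b =P c) => [->|] /=;
  rewrite /L /R; case: (c =P _) => //= ->.
Qed.

Lemma special_sig_head_nil n N c : 0 < N -> head (~~ a n) (special_sig [::] n N c) = a n.
Proof.
case: N => // N _; rewrite /special_sig /= /shiftw addn0 -/(shiftw _ _).
set w := sig _ _ _ c; have : 0 < size w by apply: nonerasing_sig.
by case: w => // d w _; rewrite ext_cons /L; case: eqP.
Qed.

(** At its first occurrence in the window [e] contributes [L e], whose images start with [e]; the
    earlier factors are [R], which keeps first letters. *)
Lemma special_sig_head1 e n N c : (exists2 i, n <= i < n + N & a i = e) ->
  head (~~ e) (special_sig [:: e] n N c) = e.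
Proof.
elim: N n => [|N IH] n [i hi ei]; first by lia.
rewrite /special_sig /= shiftwD addn1 -/(special_sig [:: e] n.+1 N) /shiftw addn0.
have hpos : 0 < size (special_sig [:: e] n.+1 N c) by apply: nonerasing_sig.
case: (a n =P e) => hn /=.
  move: hpos; rewrite hn; set w := special_sig _ _ _ _.
  by case: w => // d w _; rewrite ext_cons /L; case: eqP.
apply: (@head_LR true); first by case: (a n =P e).
have hni : n != i by apply/eqP => h; case: hn; rewrite h.
by apply: IH; exists i => //; lia.
Qed.

Lemma phi_data : exists f s p, [/\ nonerasing f, forall c d, d \in f c,
  forall y, fixed_by phi (natw y) -> app f y = y, f =1 sig a s p & 0 < size s].
Proof.
have hprim := hphi.1.
have h2 := fixed_alph hprim hfixed (dseq_letter ha hU 0 true).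
have [f [hf hmem hfix]] := primitive_power hprim h2.
have [s [p hs]] := fixed_decomposition ha hU hf (hfix _ hfixed).
exists f, s, p; split=> //; rewrite lt0n; apply/negP => /nilP e.
have : 1 < size (f false) by apply: size_ge2.
by rewrite hs e.
Qed.

Lemma directive_periodic : exists2 N, 0 < N & forall n, a (n + N) = a n.
Proof.
have [f [s [p [hf hmem hfix hs h0]]]] := phi_data.
have e := fixed_directive ha hU (hfix _ hfixed) hs.
(* Twice the length, so that a possible letter exchange cancels. *)
exists (size s + size s); first by rewrite addn_gt0 h0.
move=> n; have e' m : a (size s + m) = a m (+) p by rewrite -[LHS]/(shiftw (size s) a m) e.
by rewrite addnC -addnA !e' addbK.
Qed.

Variable N : nat.
Hypotheses (hN0 : 0 < N) (hN : forall n, a (n + N) = a n).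

Lemma char_periodic n : V (n + N) = V n.
Proof.
have h1 := charseq_shift (n + N) hV; have h2 := charseq_shift n hV.
have e : shiftw (n + N) a = shiftw n a.
  by apply/funext => i; rewrite /shiftw addnAC hN.
rewrite e in h1; have := charseq_unique (both_io_shift n ha) h1 h2.
by rewrite !addn0.
Qed.

Lemma char_mod n : V (n %% N) = V n.
Proof.
rewrite {2}(divn_eq n N) addnC; elim: (n %/ N) => [|q IH]; first by rewrite addn0.
by rewrite mulSn addnCA addnC char_periodic.
Qed.

Lemma window n b : exists2 i, n <= i < n + N & a i = b.
Proof.
have [m [hm <-]] := ha n b.
exists (n + (m - n) %% N); first by rewrite leq_addr ltn_add2l ltn_mod.
have -> : m = n + (m - n) by lia.
rewrite addKn {2}(divn_eq (m - n) N).
elim: (_ %/ N) => [|q ->]; first by rewrite mul0n add0n.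
by rewrite -hN mulSn; congr a; lia.
Qed.

Lemma special_sig_mem t n c d : d \in special_sig t n N c.
Proof.
have [i hi <-] := window n d.
have -> : a i = shiftw n a (i - n) by rewrite /shiftw subnKC //; lia.
by apply: mem_sig_dir; rewrite size_map size_iota; lia.
Qed.

Lemma special_sig_fix t n : stype t -> app (special_sig t n N) (t +++ V n) = t +++ V n.
Proof. by move=> ht; rewrite {2}(special_sig_app n N ht) char_periodic. Qed.

Lemma special_letter t n c : exists j, (t +++ V n) j = c.
Proof.
have [i hi] := dseq_letter ha (charseq_dseq hV) n c.
by exists (size t + i); rewrite -[LHS]/(shiftw (size t) _ i) shiftw_catw.
Qed.

Lemma app_head f y : nonerasing f -> app f y = y -> forall d, head d (f (y 0)) = y 0.
Proof.
by move=> hf e d; rewrite -(app0 _ _ hf) e.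
Qed.

(** If [size t <= 1], all images share their first letter and the fixed point is unique. If
    [size t = 2], all factors are [R], so the reversed [t] gives the same morphism and provides the
    second fixed point. *)
Lemma special_sig_fixed_point t n y : stype t -> app (special_sig t n N) y = y ->
  exists2 t', stype t' & y = t' +++ V n.
Proof.
move=> ht hy.
have hne : nonerasing (special_sig t n N) by apply: nonerasing_sig.
have hx := special_sig_fix n ht.
have uniq t' : stype t' -> special_sig t' n N = special_sig t n N ->
    y 0 = (t' +++ V n) 0 -> exists2 t', stype t' & y = t' +++ V n.
  move=> ht' e e0; exists t' => //; apply: (@fixed_point_unique (special_sig t n N)) => //.
    by move=> c; apply: size_ge2; apply: special_sig_mem.
  by rewrite -e special_sig_fix.
case: (y 0 =P (t +++ V n) 0) => [|h0]; first exact: uniq.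
case: t ht hy hne hx uniq h0 => [|e [|e' t]] ht hy hne hx uniq h0.
- case: h0; rewrite -(app_head hne hy (~~ a n)) -(app_head hne hx (~~ a n)).
  by rewrite !special_sig_head_nil.
- have w := window n e.
  by case: h0; rewrite -(app_head hne hy (~~ e)) -(app_head hne hx (~~ e)) !special_sig_head1.
have [ee et] : e' = ~~ e /\ t = [::].
  by move: ht; rewrite /stype !inE; clear; case: e; case: e'; case: t.
rewrite {}ee {}et in ht h0 uniq *.
apply: (uniq [:: ~~ e; e]) => //; first by case: (e).
by move: h0; rewrite !catw_cons0; case: (y 0); case: (e).
Qed.

(** A fixed point with the other first letter forces [t0] to have two letters, and the reversal of
    [t0] yields that fixed point. *)
Lemma phi_fixed_point y : fixed_by phi (natw y) -> exists2 t, stype t & y = t +++ V 0.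
Proof.
move=> hy.
have [f [s [p [hf hmem hfix hs hs0]]]] := phi_data.
have fx := hfix _ hfixed; have fy := hfix _ hy.
have f2 c : 1 < size (f c) by apply: size_ge2.
case: (y 0 =P U 0 0) => h0.
  by exists t0 => //; rewrite -eU; apply: (fixed_point_unique f2).
(* Both letters begin a fixed point, so each image begins with its own letter. *)
have hd c d : head d (f c) = c.
  have : c = y 0 \/ c = U 0 0 by move: h0; case: (y 0); case: (U 0 0); case: (c); tauto.
  by case=> ->; apply: app_head.
pose tau := lsig a (size s) p.
have htau : nonerasing tau by apply: nonerasing_lsig.
have hc : app tau (V 0) = V 0 := fixed_lsig_char ha hU fx hs hV.
have eX X : pfx a s +++ app f X = app tau X by rewrite app_lsig_sig (eq_app _ hs).
have hsz : size (pfx a s) = size (bisp a (size s)).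
  have eX' X := etrans (eX X) (app_lsig a (size s) p X).
  apply: lcp_size (eX' (fun=> false)) (eX' (fun=> true)) _ _.
    by rewrite !(app0 _ true hf) !hd.
  by rewrite !app_rsig0; case: (p).
have hpre := fixed_prefix_size ha hU fx hs hV eU.
have hlsig := size_lsig a (size s) p.
have tau2 c : 1 < size (tau c) by rewrite -size_sig -hs.
have t2 := tau2 false; have t2' := tau2 true.
(* By [hpre] and [hlsig], an extension of length at most 1 would leave an image under [tau] of
   length at most 1. *)
have [c et] : exists c, t0 = [:: c; ~~ c].
  move: hpre; rewrite hsz size_ext_count -/tau; move: hlsig; rewrite -/tau.
  case/(stypeP true): (ht0) => [|[]] ->; rewrite /cnt /=; try lia.
    by exists true.
  by exists false.
have eU' := eU; rewrite et in hpre eU'.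
have szc : size (ext tau [:: ~~ c; c]) = size (pfx a s) + 2.
  by rewrite hpre !ext_cons !size_cat /ext /= addn0 addnC addn0 -/tau.
have eT : ext tau [:: c; ~~ c] = pfx a s ++ [:: c; ~~ c].
  have := eX (U 0); rewrite fx eU' app_catw // hc -catw_cat => e.
  have [-> //] : pfx a s ++ [:: c; ~~ c] = ext tau [:: c; ~~ c] /\ V 0 = V 0.
  by apply: catw_inj e; rewrite size_cat hpre.
have eW := eX ([:: ~~ c; c] +++ V 0).
rewrite [RHS]app_catw // hc in eW.
have [|l el efl] := catw_prefix eW; first by rewrite szc leq_addr.
have sl : size l = 2 by move: szc; rewrite el size_cat => /addnI.
(* Its first letter comes from [hd], and its letter counts agree with those of [[:: c; ~~ c]] since
   [tau] maps both orders to words with equal counts. *)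
have ell : l = [:: ~~ c; c].
  have h1 : head true l = ~~ c.
    have := congr1 (fun z => z 0) efl; rewrite (app0 _ true hf) hd.
    by case: (l) sl => // l0 l1 _ ->.
  have hcn : cnt c (ext tau [:: ~~ c; c]) = cnt c (ext tau [:: c; ~~ c]).
    by rewrite !ext_cons !cnt_cat /ext /= /cnt /=; lia.
  move: hcn h1; rewrite el eT !cnt_cat => /addnI.
  by case: l sl {el efl} => [|l0 [|l1 []]] //= _ h h1; move: h; rewrite h1 /cnt /=;
    case: (c) l1 => [] [].
exists [:: ~~ c; c]; first by case: (c).
apply: (fixed_point_unique f2) => //; first by rewrite efl ell.
by move: h0; rewrite eU' !catw_cons0; case: (y 0); case: (c).
Qed.

(** The closed set consists of [phi] and the one-period products for the five extensions and the [N]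
    levels; derived words are of the form [t' +++ V m], and [V m] depends on [m] modulo [N] only. *)
Theorem special_closeable_period : closeable_under_derivation phi.
Proof.
split=> //.
pose types := [:: [::]; [:: false]; [:: true]; [:: false; true]; [:: true; false]].
exists (phi :: [seq mof (special_sig t n N) | t <- types, n <- iota 0 N]).
split; first by rewrite inE eqxx.
have hin t n : stype t ->
    mof (special_sig t (n %% N) N) \in phi :: [seq mof (special_sig t n N) | t <- types, n <- iota 0 N].
  move=> ht; rewrite inE; apply/orP; right; apply/allpairsP.
  by exists (t, n %% N); split=> //=; rewrite mem_iota /= ltn_mod.
split.
  move=> psi; rewrite inE => /orP [/eqP -> //|/allpairsP [[t n] [/= ht _ ->]]].
  apply: (@primitive_substitution_mof _ (t +++ V n)); first exact: special_sig_mem.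
  exact: special_sig_fix.
move=> psi u v hpsi hu hv.
have [y eu [t [n [ht ey]]]] : exists2 y, u = natw y & exists t n, stype t /\ y = t +++ V n.
  have hnat : alph psi = 2 -> u = natw (fun i => u i == 1).
    by move=> e; apply: natw_surj => i; have := hu.1 i; rewrite e.
  move: hpsi; rewrite inE => /orP [/eqP epsi|/allpairsP [[t n] [/= ht _ epsi]]].
    have e2 : alph psi = 2.
      by rewrite epsi; exact: (fixed_alph hphi.1 hfixed (dseq_letter ha hU 0 true)).
    exists (fun i => u i == 1); first exact: hnat.
    rewrite epsi (hnat e2) in hu.
    by have [t ht e] := phi_fixed_point hu; exists t, 0.
  have e2 : alph psi = 2 by rewrite epsi.
  exists (fun i => u i == 1); first exact: hnat.
  rewrite epsi (hnat e2) in hu.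
  have hy := fixed_app (@mof_represents _) (@nonerasing_sig _ _ _) hu.
  by have [t' ht' e] := special_sig_fixed_point ht hy; exists t', n.
rewrite {}eu {}ey in hu hv *.
have [v' -> hocc] := factor_nats hv.
have [m [t' [ht' hd]]] := special_der_all ha hV ht hocc.
exists (natw (t' +++ V m)), (mof (special_sig t' (m %% N) N)); split.
  by apply: der_derived_word hd _; apply: special_letter.
split; first exact: hin.
rewrite -char_mod; apply: app_fixed; first exact: nonerasing_sig.
exact: special_sig_fix.
Qed.

End ClosedIf.

Theorem special_closeable a V U t phi : both_io a -> charseq a V -> dseq a U ->
  stype t -> U 0 = t +++ V 0 -> primitive_substitution phi ->
  fixed_by phi (natw (U 0)) -> closeable_under_derivation phi.
Proof.
move=> ha hV hU ht eU hphi hfix.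
have [N h0 hN] := directive_periodic ha hU hphi hfix.
exact: (special_closeable_period ha hV hU ht eU hphi hfix h0 hN).
Qed.

Import Order.TTheory GRing.Theory Num.Theory.
Local Open Scope ring_scope.

(** * Codings of two interval exchanges *)

Section Coding.
Variables (K : realType) (upper : bool).
Implicit Types l r : K.

Definition inI0 l0 r : bool := if upper then r <= l0 else r < l0.
Definition inI l r : bool := if upper then 0 < r <= l else 0 <= r < l.
Definition T2 l0 l1 r : K := if inI0 l0 r then r + l1 else r - l0.
Definition code l0 l1 r : word := fun n => ~~ inI0 l0 (iter n (T2 l0 l1) r).

Lemma code_shift l0 l1 r n : shiftw n (code l0 l1 r) = code l0 l1 (iter n (T2 l0 l1) r).
Proof. by apply/funext => i; rewrite /shiftw /code addnC iterD. Qed.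

Lemma code_cons l0 l1 r :
  code l0 l1 r = [:: ~~ inI0 l0 r] +++ code l0 l1 (T2 l0 l1 r).
Proof. by rewrite -[in LHS](catw_shiftw1 (code _ _ _)) code_shift. Qed.

(** Rauzy induction on the first interval: a point either stays there, or visits the second interval
    once before returning. *)
Lemma code_L_false l0 l1 r : 0 < l1 -> l1 < l0 -> inI l0 r ->
  code l0 l1 r = app (L false) (code (l0 - l1) l1 r).
Proof.
move=> h1 h0 hr.
pose Q X Y := exists2 r, inI l0 r & X = code l0 l1 r /\ Y = code (l0 - l1) l1 r.
apply: (app_unique (Q := Q)) => //; last by exists r.
move=> X Y [{hr}r hr [-> ->]].
exists (code l0 l1 (T2 (l0 - l1) l1 r)); split; last first.
  exists (T2 (l0 - l1) l1 r); last by rewrite code_shift.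
  by move: hr; rewrite /T2 /inI /inI0; case: upper => hr; case: ifP => h; lra.
have in0 : inI0 l0 r by move: hr; rewrite /inI /inI0; case: upper; lra.
rewrite -[code (l0 - l1) l1 r 0%N]/(~~ inI0 (l0 - l1) r).
rewrite [in LHS]code_cons in0 /T2 in0.
case: (boolP (inI0 (l0 - l1) r)) => h //=.
rewrite [in LHS]code_cons -catw_cat.
have -> : inI0 l0 (r + l1) = false.
  by apply/negbTE; move: h hr; rewrite /inI0 /inI; case: upper; lra.
congr (_ +++ code _ _ _); rewrite /T2.
have -> : inI0 l0 (r + l1) = false.
  by apply/negbTE; move: h hr; rewrite /inI0 /inI; case: upper; lra.
by lra.
Qed.

(** Rauzy induction on the second interval; adding [l0] translates the induced exchange back to its
    place. *)
Lemma code_L_true l0 l1 r : 0 < l0 -> l0 < l1 -> inI l1 r ->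
  code l0 l1 (r + l0) = app (L true) (code l0 (l1 - l0) r).
Proof.
move=> h0 h1 hr.
pose Q X Y := exists2 r, inI l1 r & X = code l0 l1 (r + l0) /\ Y = code l0 (l1 - l0) r.
apply: (app_unique (Q := Q)) => //; last by exists r.
move=> X Y [{hr}r hr [-> ->]].
exists (code l0 l1 (T2 l0 (l1 - l0) r + l0)); split; last first.
  exists (T2 l0 (l1 - l0) r); last by rewrite code_shift.
  by move: hr; rewrite /T2 /inI /inI0; case: upper => hr; case: ifP => h; lra.
have in1 : inI0 l0 (r + l0) = false.
  by apply/negbTE; move: hr; rewrite /inI /inI0; case: upper; lra.
rewrite -[code l0 (l1 - l0) r 0%N]/(~~ inI0 l0 r).
rewrite [in LHS]code_cons in1 /T2 in1 addrK.
case: (boolP (inI0 l0 r)) => h //=; last by rewrite subrK.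
rewrite [in LHS]code_cons -catw_cat h /T2 h.
by congr (_ +++ code _ _ _); lra.
Qed.

Variables (l0 l1 : K).
Hypotheses (l0_gt0 : 0 < l0) (l1_gt0 : 0 < l1).
Hypothesis indep : forall m n : nat, l0 * m%:R = l1 * n%:R -> m = 0%N /\ n = 0%N.

(** The subtractive Euclidean algorithm on the two lengths. *)
Fixpoint len n : K * K :=
  if n is m.+1 then
    let l := len m in if l.1 < l.2 then (l.1, l.2 - l.1) else (l.1 - l.2, l.2)
  else (l0, l1).
Definition dir : word := fun n => (len n).1 < (len n).2.
(** The first point of the orbit in the longer interval, translated so that this interval starts at
    0. *)
Definition rstep (l : K * K) r : K :=
  if l.1 < l.2 then (if inI0 l.1 r then r + l.2 - l.1 else r - l.1)
  else (if inI0 l.1 r then r else r - l.1).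

Lemma len_indep n : [/\ 0 < (len n).1, 0 < (len n).2 &
  forall i j : nat, (len n).1 * i%:R = (len n).2 * j%:R -> i = 0%N /\ j = 0%N].
Proof.
elim: n => [|n [h0 h1 hi]] //=.
have hne : (len n).1 != (len n).2.
  by apply/eqP => e; have := hi 1%N 1%N; rewrite e => /(_ erefl) [].
case: (ltgtP (len n).1 (len n).2) hne => //= hlt _; rewrite subr_gt0; split=> // i j.
  move=> e; have [|/eqP] := hi (i + j)%N j.
    by rewrite natrD mulrDr e mulrBl subrK.
  by rewrite addn_eq0 => /andP [/eqP -> /eqP ->].
move=> e; have [|->/eqP] := hi i (j + i)%N.
  by rewrite natrD mulrDr -e mulrBl subrK.
by rewrite addn_eq0 => /andP [/eqP -> _].
Qed.

Lemma len_neq n : (len n).1 != (len n).2.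
Proof.
have [_ _ hi] := len_indep n.
by apply/eqP => e; have := hi 1%N 1%N; rewrite e => /(_ erefl) [].
Qed.

Lemma rstep_inI n r : inI ((len n).1 + (len n).2) r ->
  inI ((len n.+1).1 + (len n.+1).2) (rstep (len n) r).
Proof.
have [h0 h1 _] := len_indep n; have := len_neq n; rewrite /= /rstep.
case: ltgtP => //= h _; rewrite /inI /inI0; case: upper => hr; case: ifP => h'; lra.
Qed.

Lemma code_rstep n r : inI ((len n).1 + (len n).2) r ->
  let y := code (len n.+1).1 (len n.+1).2 (rstep (len n) r) in
  code (len n).1 (len n).2 r =
    if inI0 (len n).1 r == ~~ dir n then app (L (dir n)) y
    else [:: ~~ dir n] +++ app (L (dir n)) y.
Proof.
have [h0 h1 _] := len_indep n; have := len_neq n; rewrite /= /rstep /dir.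
move: (len n) h0 h1 => [m0 m1] /= h0 h1.
case: ltgtP => //= h _ hr; case: (boolP (inI0 m0 r)) => hi /=.
- rewrite -code_L_true //; last by move: hi hr; rewrite /inI /inI0; case: upper; lra.
  by rewrite code_cons hi /T2 hi subrK.
- rewrite -code_L_true ?subrK //.
  by move: hi hr; rewrite /inI /inI0; case: upper; lra.
- by rewrite -code_L_false //; move: hi hr; rewrite /inI /inI0; case: upper; lra.
- rewrite -code_L_false //; last by move: hi hr; rewrite /inI /inI0; case: upper; lra.
  by rewrite code_cons (negbTE hi) /T2 (negbTE hi).
Qed.

Definition rho (r : K) := fix rho n := if n is m.+1 then rstep (len m) (rho m) else r.

Lemma rho_inI r n : inI (l0 + l1) r -> inI ((len n).1 + (len n).2) (rho r n).
Proof. by move=> h; elim: n => //= n IH; apply: rstep_inI. Qed.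

Lemma code_dseq r : inI (l0 + l1) r ->
  dseq dir (fun n => code (len n).1 (len n).2 (rho r n)).
Proof.
move=> h n; have := code_rstep (rho_inI n h) => /= ->.
by case: ifP => _; [left|right].
Qed.

(** The point [(len n).2] always lies in the longer interval, and [rstep] sends it to the next
    second length. *)
Lemma code_charseq : charseq dir (fun n => code (len n).1 (len n).2 (len n).2).
Proof.
move=> n; have [h0 h1 _] := len_indep n; have hne := len_neq n.
have hin : inI ((len n).1 + (len n).2) (len n).2.
  by rewrite /inI; case: upper; lra.
have := code_rstep hin => /= ->.
have -> : inI0 (len n).1 (len n).2 = ~~ dir n.
  by rewrite /inI0 /dir; move: hne; case: upper; case: ltgtP.
rewrite eqxx; congr (app _ (code _ _ _)); rewrite /rstep.
have -> : inI0 (len n).1 (len n).2 = ~~ dir n.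
  by rewrite /inI0 /dir; move: hne; case: upper; case: ltgtP.
by rewrite /dir; case: ltP.
Qed.

(** If one letter recurred forever, the same length [mn] would be subtracted from the other
    arbitrarily often, against the Archimedean property. *)
Lemma len_archi n b : exists m, (n <= m)%N /\ dir m = b.
Proof.
apply: contrapT => hno.
have hall m : (n <= m)%N -> dir m = ~~ b.
  by move=> hm; have : dir m <> b by [move=> e; apply: hno; exists m]; case: (dir m); case: (b).
have [h0 h1 _] := len_indep n.
pose mn := if b then (len n).2 else (len n).1.
pose mx := if b then (len n).1 else (len n).2.
have mn0 : 0 < mn by rewrite /mn; case: (b).
have hk k : (if b then (len (n + k)).2 else (len (n + k)).1) = mn /\
    (if b then (len (n + k)).1 else (len (n + k)).2) = mx - mn * k%:R.
  elim: k => [|k [IH1 IH2]]; first by rewrite addn0 mulr0 subr0.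
  have := hall (n + k)%N (leq_addr _ _); rewrite addnS /= /dir -natr1 mulrDr mulr1.
  by move: (mn) (mx) IH1 IH2; case: (b) => n' x' /= IH1 IH2 -> /=; split=> //; lra.
pose k := Num.bound (mx / mn).
have mx0 : 0 < mx by rewrite /mx; case: (b).
have hbd : mx < mn * k%:R.
  by rewrite mulrC -ltr_pdivrMr //; apply: archi_boundP; rewrite divr_ge0 // ltW.
have [_ e] := hk k; have [g0 g1 _] := len_indep (n + k).
by move: (mn) (mx) g0 g1 e hbd; case: (b) => /= ? ? ? ? ? ?; lra.
Qed.

Lemma dir_both_io : both_io dir.
Proof. by move=> n b; exact: len_archi. Qed.

Lemma dir_switch n : exists2 m, (n <= m)%N & dir m != dir m.+1.
Proof.
apply: contrapT => hno.
have hall m : (n <= m)%N -> dir m = dir n.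
  move=> hm; rewrite -(subnKC hm); elim: (m - n)%N => [|k IH]; first by rewrite addn0.
  rewrite addnS -IH; apply/esym/eqP/negPn/negP => h.
  by apply: hno; exists (n + k)%N => //; apply: leq_addr.
have [m [hm e]] := len_archi n (~~ dir n).
by move: e; rewrite hall //; case: (dir n).
Qed.

Let sum n := (len n).1 + (len n).2.

Lemma sum_decr n k : sum (n + k) <= sum n.
Proof.
elim: k => [|k IH]; first by rewrite addn0.
apply: le_trans IH; rewrite addnS /sum /=; have [h0 h1 _] := len_indep (n + k).
by case: ifP => _ /=; lra.
Qed.

(** At a switch the length just subtracted is at least the other new length, hence at least half of
    the new total. *)
Lemma sum_switch n e : dir n != dir n.+1 -> e <= sum n.+1 -> sum n.+1 <= sum n - e / 2.
Proof.
have [h0 h1 _] := len_indep n; rewrite /sum /dir /=.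
by case: ltP => h /=; case: ltP => h' //= _ he; lra.
Qed.

Lemma sum_small (e : K) : 0 < e -> exists n, sum n < e.
Proof.
move=> he; apply: contrapT => hno.
have hge n : e <= sum n by rewrite leNgt; apply/negP => h; apply: hno; exists n.
have hk k : exists n, sum n <= sum 0%N - e / 2 * k%:R.
  elim: k => [|k [n hn]]; first by exists 0%N; rewrite mulr0 subr0.
  have [m hm hsw] := dir_switch n; exists m.+1.
  have := sum_switch hsw (hge _); have := sum_decr n (m - n); rewrite subnKC //.
  by rewrite -(addn1 k) natrD mulrDr mulr1; lra.
pose k := Num.bound (sum 0%N / (e / 2)).
have s0 : 0 < sum 0%N by apply: addr_gt0.
have e2 : 0 < e / 2 by lra.
have hbd : sum 0%N < e / 2 * k%:R.
  by rewrite mulrC -ltr_pdivrMr //; apply: archi_boundP; rewrite divr_ge0 // ltW.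
by have [n hn] := hk k; have := hge n; lra.
Qed.

(** With only first alternatives, the point and the second length undergo the same translations, so
    their difference is invariant; it is bounded by total lengths that become arbitrarily small. *)
Lemma charseq_code V r : inI (l0 + l1) r -> charseq dir V -> V 0%N = code l0 l1 r -> r = l1.
Proof.
move=> hr hV eV.
have hun := dseq_unique dir_both_io dir_both_io (charseq_dseq hV) (code_dseq hr) eV.
have hinv n : rho r n - (len n).2 = r - l1.
  elim: n => //= n <-.
  have hd : ~~ inI0 (len n).1 (rho r n) = dir n.
    have [e _] := hun n; have := congr1 (fun z => z 0%N) (hV n).
    by rewrite e app_L0 => <-.
  move: hd; rewrite /rstep /dir; case: ltP => h /= /negbRL -> /=; lra.
apply/eqP; rewrite -subr_eq0; apply/negPn/negP => hne.
have [|n] := @sum_small `|r - l1|; first by rewrite normr_gt0.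
have [h0 h1 _] := len_indep n; have := rho_inI n hr.
rewrite -(hinv n) /sum /inI.
by case: (ger0P (_ - _)) => h; case: upper; lra.
Qed.

End Coding.

Lemma codes_2iet_code (K : realType) (l0 l1 r : K) u : codes_2iet l0 l1 r u ->
  exists upper, inI upper (l0 + l1) r /\ u = natw (code upper l0 l1 r).
Proof.
move=> [_ [[h0 [h1 hu]]|[h0 [h1 hu]]]]; [exists false|exists true]; rewrite /inI h0 h1; split=> //;
  by apply/funext => n; rewrite hu /natw /code /inI0; case: ifP => _.
Qed.

(** Both directions compare the orbit of [delta] with [gamma], whose coding is the characteristic
    word: the four values are those for which the orbit reaches [gamma] within two steps. *)
Theorem theorem33 (R : realType) (gamma delta : R) (u : nat -> nat) (phi : morph) :
  0 <= gamma <= 1 -> 0 <= delta <= 1 -> irrational gamma ->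
  codes_2iet (1 - gamma) gamma delta u ->
  primitive_substitution phi -> fixed_by phi u ->
  (closeable_under_derivation phi <->
     (delta = 0 \/ delta = gamma \/ delta = 1 - gamma \/ delta = 1)).
Proof.
move=> _ _ hirr hcode hphi hfix.
have [g0 g1] := hcode.1.
have [upper [hin eu]] := codes_2iet_code hcode.
have hindep (m n : nat) : (1 - gamma) * m%:R = gamma * n%:R -> m = 0%N /\ n = 0%N.
  move=> e; have e' : gamma * (m + n)%:R = m%:R by rewrite natrD; lra.
  case: (posnP (m + n)%N) => [/eqP|hpos].
    by rewrite addn_eq0 => /andP [/eqP -> /eqP ->].
  exfalso; apply: hirr; apply/rationalP; exists (Posz m), (m + n)%N.
  rewrite -[_%:~R]/(m%:R) -e' mulfK // pnatr_eq0; lia.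
have hio := dir_both_io g0 g1 hindep.
have hU := code_dseq g0 g1 hindep hin.
have hC := code_charseq upper g0 g1 hindep.
rewrite eu in hfix.
split.
  move=> [_ [M [hphiM hM]]].
  have [E [V [hV hE hE2]]] := closed_special hM hio hU hphiM hfix.
  move: hE; rewrite /= code_shift => hE.
  have hinE : inI upper (1 - gamma + gamma) (iter E (T2 upper (1 - gamma) gamma) delta).
    elim: (E) => //= n; move: (iter _ _ _) => r.
    by rewrite /inI /T2 /inI0; case: (upper) => hr; case: ifP => h; lra.
  have := charseq_code g0 g1 hindep hinE hV (esym hE).
  (* Zero steps give [gamma], one step gives an endpoint, and two steps give [1 - gamma]. *)
  move: hin; case: E hE2 {hE hinE} => [|[|[|//]]] _ /=; first by right; left.
    rewrite /inI /T2 /inI0; case: (upper) => hr; case: ifP => h e.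
    - by left; lra.
    - by right; right; right; lra.
    - by left; lra.
    - by right; right; right; lra.
  rewrite /inI {2}/T2 /inI0; case: (upper) => hr; case: ifP => h; rewrite /T2 /inI0 /=;
    case: ifP => h' e; try (exfalso; lra); by right; right; left; lra.
have hstep d : code upper (1 - gamma) gamma d =
    [:: ~~ inI0 upper (1 - gamma) d] +++ code upper (1 - gamma) gamma (T2 upper (1 - gamma) gamma d).
  exact: code_cons.
move=> hd; suff [t ht et] : exists2 t, stype t &
    code upper (1 - gamma) gamma delta = t +++ code upper (1 - gamma) gamma gamma.
  exact: (special_closeable hio hC hU ht et hphi hfix).
have step d e c : ~~ inI0 upper (1 - gamma) d = c -> T2 upper (1 - gamma) gamma d = e ->
    code upper (1 - gamma) gamma d = [:: c] +++ code upper (1 - gamma) gamma e.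
  by move=> <- <-; exact: hstep.
case: hd hin => [->|[->|[->|->]]] hin.
- exists [:: false] => //; apply: step; first by move: hin; rewrite /inI /inI0; case: (upper); lra.
  by move: hin; rewrite /T2 /inI /inI0; case: (upper) => ?; case: ifP => ?; lra.
- by exists [::] => //; rewrite catw_nil.
(* From [1 - gamma] the orbit passes through the endpoint [upper%:R], which is 0 or 1, and then
   reaches [gamma]. *)
- exists [:: ~~ upper; upper]; first by case: (upper).
  rewrite -[[:: ~~ upper; upper]]/([:: ~~ upper] ++ [:: upper]) catw_cat.
  rewrite (@step _ (upper%:R) (~~ upper)); last 2 first.
  + by rewrite /inI0; case: (upper); rewrite ?lexx ?ltxx.
  + by rewrite /T2 /inI0; case: (upper); rewrite ?lexx ?ltxx /=; lra.
  congr (_ +++ _); apply: step.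
  + by rewrite /inI0; case: (upper) => /=; lra.
  + by rewrite /T2 /inI0; case: (upper) => /=; case: ifP => h; lra.
- exists [:: true] => //; apply: step; first by move: hin; rewrite /inI /inI0; case: (upper); lra.
  by move: hin; rewrite /T2 /inI /inI0; case: (upper) => ?; case: ifP => ?; lra.
Qed.
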